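(* Under the Setup and the Unconditional asymptotic regime described in the context, for $i,j\in\{0,1\}$, $$\lim_{p\to\infty}E_{\boldsymbol\mu,S_n}[\hat\varepsilon_i^B\hat\varepsilon_j^B]=\Phi\!\left((-1)^i\frac{-H_i+c}{\sqrt F}\right)\Phi\!\left((-1)^j\frac{-H_j+c}{\sqrt F}\right),$$ and consequently $$\lim_{p\to\infty}E_{\boldsymbol\mu,S_n}[(\hat\varepsilon^B)^2]=\left[\alpha_0\Phi\!\left(\frac{-H_0+c}{\sqrt F}\right)+\alpha_1\Phi\!\left(\frac{H_1-c}{\sqrt F}\right)\right]^2,$$ where $H_0=\frac12\big(\bar\Delta^2_{\mathbf m}+J_1-J_0+\frac{J_0}{\gamma_0}+\frac{J_1}{\gamma_1}\big)$, $H_1=-\frac12\big(\bar\Delta^2_{\mathbf m}+J_0-J_1+\frac{J_0}{\gamma_0}+\frac{J_1}{\gamma_1}\big)$, and $F=\bar\Delta^2_{\mathbf m}+J_0+J_1+\frac{J_0}{\gamma_0}+\frac{J_1}{\gamma_1}$.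
   Context: Setup. Fix $\alpha_0\in(0,1)$, $\alpha_1=1-\alpha_0$, and $c=\log\frac{1-\alpha_0}{\alpha_0}$. $\Phi$ is the standard normal CDF. For each dimension $p$ there is a known symmetric positive definite $p\times p$ matrix $\Sigma$, sample sizes $n_0,n_1$, prior means $\mathbf m_0,\mathbf m_1\in\mathbb R^p$ and prior certainty parameters $\nu_0,\nu_1>0$ (all depending on $p$; the index $p$ is suppressed). The class means are random: $\boldsymbol\mu_i\sim N(\mathbf m_i,\Sigma/\nu_i)$, $i=0,1$, independent; $\boldsymbol\mu=(\boldsymbol\mu_0,\boldsymbol\mu_1)$. Given $\boldsymbol\mu$, class $i$ has distribution $\Pi_i=N(\boldsymbol\mu_i,\Sigma)$, and the sample $S_n$ consists of $n_0$ i.i.d. points from $\Pi_0$ and, independently, $n_1$ i.i.d. points from $\Pi_1$; $\bar{\mathbf x}_0,\bar{\mathbf x}_1$ are the class sample means. The LDA classifier assigns $\mathbf x$ to class 1 if $W(\mathbf x)\le c$ and to class 0 otherwise, where $W(\mathbf x)=(\mathbf x-\frac{\bar{\mathbf x}_0+\bar{\mathbf x}_1}{2})^T\Sigma^{-1}(\bar{\mathbf x}_0-\bar{\mathbf x}_1)$. Let $\hat\delta^2=(\bar{\mathbf x}_0-\bar{\mathbf x}_1)^T\Sigma^{-1}(\bar{\mathbf x}_0-\bar{\mathbf x}_1)$. The true error is $\varepsilon=\alpha_0\varepsilon_0+\alpha_1\varepsilon_1$ with $\varepsilon_i=\Phi\Big(\frac{(-1)^{i+1}(\boldsymbol\mu_i-\frac{\bar{\mathbf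 x}_0+\bar{\mathbf x}_1}{2})^T\Sigma^{-1}(\bar{\mathbf x}_0-\bar{\mathbf x}_1)+(-1)^i c}{\hat\delta}\Big)$. The Bayesian MMSE error estimator is $\hat\varepsilon^B=\alpha_0\hat\varepsilon^B_0+\alpha_1\hat\varepsilon^B_1$ with $\hat\varepsilon_i^B=\Phi\Big((-1)^i\frac{-(\mathbf m_i^*-\frac{\bar{\mathbf x}_0+\bar{\mathbf x}_1}{2})^T\Sigma^{-1}(\bar{\mathbf x}_0-\bar{\mathbf x}_1)+c}{\hat\delta}\sqrt{\frac{\nu_i^*}{\nu_i^*+1}}\Big)$, where $\mathbf m_i^*=\frac{n_i\bar{\mathbf x}_i+\nu_i\mathbf m_i}{n_i+\nu_i}$ and $\nu_i^*=n_i+\nu_i$. Notation: $\Delta^2_{\mathbf m}=(\mathbf m_0-\mathbf m_1)^T\Sigma^{-1}(\mathbf m_0-\mathbf m_1)$, and $\bar\Delta^2_{\mathbf m}$ its limit as $p\to\infty$. Unconditional asymptotic regime. Expectations $E_{\boldsymbol\mu,S_n}$ are over both $\boldsymbol\mu$ and the sample. As $p\to\infty$: $n_0,n_1,\nu_0,\nu_1\to\infty$, $p/n_i\to J_i\in[0,\infty)$, $\nu_i/n_i\to\gamma_i\in(0,\infty)$, and for all $i,j\in\{0,1\}$, $\mathbf m_i^T\Sigma^{-1}\mathbf m_j$ converges to a finite limit. It is assumed that $F>0$ (with $F$ as in the claim). $\lim_{p\to\infty}$ denotes the limit along this regime. *)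

(* Defs.v *)
From HB Require Import structures.
From mathcomp Require Import all_boot all_order all_algebra.
From mathcomp Require Import all_classical all_reals all_analysis.
Set Implicit Arguments. Unset Strict Implicit. Unset Printing Implicit Defensive.
Import Order.TTheory GRing.Theory Num.Theory.
Import numFieldNormedType.Exports.
Local Open Scope classical_set_scope.
Local Open Scope ring_scope.

Section defs.
Variable R : realType.

Definition Phi (x : R) : R := fine (normal_prob (0:R) 1 `]-oo, x]).

Definition qf (p : nat) (A : 'M[R]_p) (u v : 'cV[R]_p) : R := (u^T *m A *m v) 0 0.

Definition std_normal_rv d (T : measurableType d) (P : probability T R)
  (X : T -> R) : Prop :=
  measurable_fun setT X /\
  forall A : set R, measurable A -> P (X @^-1` A) = normal_prob (0:R) 1 A.

(** Mutual independence of a finite family of real random variables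
    (product rule; taking B i = setT recovers every subfamily). *)
Definition mutually_independent d (T : measurableType d) (P : probability T R)
  (I : finType) (X : I -> T -> R) : Prop :=
  (forall i, measurable_fun setT (X i)) /\
  forall B : I -> set R, (forall i, measurable (B i)) ->
    fine (P (\bigcap_(i in [set: I]) (X i @^-1` B i)))
    = \prod_(i : I) fine (P (X i @^-1` B i)).

(** All scalar coordinates of the standard Gaussian vectors z_i (i in {0,1})
    and w_{i,k} (k < n_i), indexed by ({i & option 'I_(n i)}) * 'I_p
    (None  ~ z_i, Some k ~ w_{i,k}). *)
Definition gcoord (T : Type) (p : nat) (n : 'I_2 -> nat)
  (z : 'I_2 -> T -> 'cV[R]_p) (w : forall i : 'I_2, 'I_(n i) -> T -> 'cV[R]_p)
  (k : {i : 'I_2 & option 'I_(n i)} * 'I_p) : T -> R :=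
  fun t => let: existT i o := k.1 in
           match o with
           | None => z i t k.2 0
           | Some l => w i l t k.2 0
           end.

Definition smean (p n : nat) (x : 'I_n -> 'cV[R]_p) : 'cV[R]_p :=
  (n%:R)^-1 *: \sum_(k < n) x k.

Definition bayes_err_comp (p : nat) (Sigma : 'M[R]_p) (c : R) (i : 'I_2)
  (ni : nat) (nui : R) (mi xb0 xb1 : 'cV[R]_p) : R :=
  let Si := invmx Sigma in
  let dd := xb0 - xb1 in
  let deltahat := Num.sqrt (qf Si dd dd) in
  let xbi := if i == 0 then xb0 else xb1 in
  let nustar := ni%:R + nui in
  let mstar := nustar^-1 *: (ni%:R *: xbi + nui *: mi) in
  Phi ((-1) ^+ i *
       ((- qf Si (mstar - 2^-1 *: (xb0 + xb1)) dd + c) / deltahat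
        * Num.sqrt (nustar / (nustar + 1)))).

Definition Hlim (Dbar : R) (J gamma : 'I_2 -> R) (i : 'I_2) : R :=
  if i == 0 then
    2^-1 * (Dbar + J 1 - J 0 + J 0 / gamma 0 + J 1 / gamma 1)
  else
    - 2^-1 * (Dbar + J 0 - J 1 + J 0 / gamma 0 + J 1 / gamma 1).

Definition Flim (Dbar : R) (J gamma : 'I_2 -> R) : R :=
  Dbar + J 0 + J 1 + J 0 / gamma 0 + J 1 / gamma 1.

End defs.

(* Main.v *)
Require Import Defs.
From HB Require Import structures.
From mathcomp Require Import all_boot all_order all_algebra.
From mathcomp Require Import all_classical all_reals all_analysis.
From mathcomp Require Import measurable_realfun zify ring lra.
Import Order.TTheory GRing.Theory Num.Theory.
Import numFieldNormedType.Exports.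
Set Implicit Arguments.
Unset Strict Implicit.
Unset Printing Implicit Defensive.
Local Open Scope classical_set_scope.
Local Open Scope ring_scope.

(** After whitening by [L^-1], the class sample means become [u_i + g_i] with
    [u_i = L^-1 m_i] and [g_0], [g_1] independent centred Gaussian vectors of
    covariance [(1/nu_i + 1/n_i) I], and the estimator is a fixed continuous
    function of [|u_0 - u_1|^2], [<u_0 - u_1, g_i>], [|g_0|^2], [|g_1|^2] and
    [|g_0 - g_1|^2], up to coefficients that converge deterministically.
    Second and fourth moments of linear forms in i.i.d. standard normal variables
    (Isserlis' formula) bound the variances of the random terms by quantities of
    order [1/p], so each of them converges in probability to a constant and so does
    the estimator; being bounded by 1, its product moments converge to the products
    of the limits. *)

(** * Means, densities and push-forwards *)

(** Independence is available only as a product rule for events, whereas the variances require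
    expectations of products of up to four unbounded coordinates. The passage from one to the other
    is the main obstacle; it is reduced to a weighted change of variables, which also turns Lebesgue
    integrals against the Gaussian density into integrals over [normal_prob]. No conditioning on the
    class means takes place: prior noise and sampling noise are both linear in the coordinates
    [gcoord], so all that concerns [g_0] and [g_1] follows from moments of linear forms. Each
    coordinate of [g_i] has variance [s_i = 1/nu_i + 1/n_i], at most of order [1/p]. Hence [|g_i|^2]
    has mean [p s_i], with limit [J_i/gamma_i + J_i], the source of the [J] terms in [Hlim] and
    [Flim], while its variance [2 p s_i^2] vanishes. *)

Section density_pushforward.
Import HBNNSimple.

(** The identity on indicators extends to simple functions by linearity and to [f] by monotone
    convergence. It serves with a Gaussian density as [h], with [h = 1], and with a product of
    functions of other coordinates as [h]. *)
Lemma ge0_integral_density_pushforward (d d' : measure_display)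
    (T : measurableType d) (U : measurableType d') (R : realType)
    (mu : {measure set T -> \bar R}) (nu : {measure set U -> \bar R})
    (X : T -> U) (h : T -> R) (f : U -> R) :
  measurable_fun setT X -> measurable_fun setT h -> (forall t, 0 <= h t) ->
  (forall A, measurable A -> \int[mu]_t (h t * \1_A (X t))%:E = nu A)%E ->
  measurable_fun setT f -> (forall u, 0 <= f u) ->
  (\int[mu]_t (h t * f (X t))%:E = \int[nu]_u (f u)%:E)%E.
Proof.
move=> mX mh h0 hA mf f0.
have mE (A : set U) : measurable A ->
    measurable_fun setT (fun t => h t * \1_A (X t)).
  move=> mA; apply: measurable_funM => //.
  exact: (measurableT_comp (measurable_indic mA) mX).
have simple (g : {nnsfun U >-> R}) :
    (\int[mu]_t (h t * g (X t))%:E = \int[nu]_u (g u)%:E)%E.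
  rewrite integralT_nnsfun sintegralE.
  transitivity (\int[mu]_t (\sum_(r \in range g)
      (r * (h t * \1_(g @^-1` [set r]) (X t)))%:E))%E.
    apply: eq_integral => t _; rewrite [in LHS]fimfunE mulrC.
    rewrite EFinM -fsumEFin// ge0_mule_fsuml; last first.
      by move=> r; rewrite EFinM nnfun_muleindic_ge0.
    by apply: eq_fsbigr => r _; rewrite -!EFinM mulrAC mulrA.
  rewrite ge0_integral_fsum//; last 2 first.
    - by move=> r; apply/measurable_EFinP/measurable_funM => //; exact: mE.
    - move=> r t _; rewrite mulrCA EFinM mule_ge0// ?lee_fin//.
      by rewrite -lee_fin EFinM nnfun_muleindic_ge0.
  apply: eq_fsbigr => r /[!inE] -[u _ <-].
  under eq_integral do rewrite EFinM.
  rewrite ge0_integralZl//; first by rewrite hA.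
  - by apply/measurable_EFinP; exact: mE.
  - by move=> t _; rewrite lee_fin mulr_ge0.
  - by rewrite lee_fin.
have mEf : measurable_fun setT (EFin \o f) by exact/measurable_EFinP.
pose f_ := nnsfun_approx measurableT mEf.
have cvgf u : (f_ n u)%:E @[n --> \oo] --> (f u)%:E.
  by apply: (cvg_nnsfun_approx measurableT mEf) => // x _; rewrite lee_fin.
transitivity (limn (fun n => \int[mu]_t (h t * f_ n (X t))%:E))%E; last first.
  under eq_fun do rewrite simple.
  rewrite -monotone_convergence//.
  - by apply: eq_integral => u _; exact/cvg_lim.
  - by move=> n; exact/measurable_EFinP.
  - by move=> n u _; rewrite lee_fin.
  - by move=> u _ m n mn; rewrite lee_fin; exact/lefP/nd_nnsfun_approx.
rewrite -monotone_convergence//.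
- apply: eq_integral => t _; apply/esym/cvg_lim => //.
  under eq_fun do rewrite EFinM; rewrite EFinM.
  by apply: cvgeZl => //; exact: cvgf.
- move=> n; apply/measurable_EFinP/measurable_funM => //.
  exact: measurableT_comp.
- by move=> n t _; rewrite lee_fin mulr_ge0.
- move=> t _ m n mn; rewrite lee_fin ler_wpM2l//.
  exact/lefP/nd_nnsfun_approx.
Qed.

End density_pushforward.

(** Integrability is bundled with a real value, so that means are added and scaled in [R] without
    integrability side conditions. *)
Definition has_mean (d : measure_display) (T : measurableType d) (R : realType)
    (mu : {measure set T -> \bar R}) (f : T -> R) (m : R) : Prop :=
  mu.-integrable setT (EFin \o f) /\ (\int[mu]_t (f t)%:E = m%:E)%E.

Lemma has_mean_measurable (d : measure_display) (T : measurableType d)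
    (R : realType) (mu : {measure set T -> \bar R}) (f : T -> R) (m : R) :
  has_mean mu f m -> measurable_fun setT f.
Proof. by move=> [/measurable_int/measurable_EFinP]. Qed.

Lemma ge0_has_mean (d : measure_display) (T : measurableType d) (R : realType)
    (mu : {measure set T -> \bar R}) (f : T -> R) (m : R) :
  measurable_fun setT f -> (forall t, 0 <= f t) ->
  (\int[mu]_t (f t)%:E = m%:E)%E -> has_mean mu f m.
Proof.
move=> mf f0 fm; split=> //; apply/integrableP; split; first exact/measurable_EFinP.
under eq_integral do rewrite /= ger0_norm//.
by rewrite fm ltry.
Qed.

Lemma has_meanD (d : measure_display) (T : measurableType d) (R : realType)
    (mu : {measure set T -> \bar R}) (f g : T -> R) (a b : R) :
  has_mean mu f a -> has_mean mu g b ->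
  has_mean mu (fun t => f t + g t) (a + b).
Proof.
move=> [fi fa] [gi gb]; split.
  by apply: eq_integrable (integrableD measurableT fi gi).
under eq_integral do rewrite EFinD.
by rewrite integralD_EFin//= fa gb.
Qed.

Lemma has_meanZ (d : measure_display) (T : measurableType d) (R : realType)
    (mu : {measure set T -> \bar R}) (k : R) (f : T -> R) (a : R) :
  has_mean mu f a -> has_mean mu (fun t => k * f t) (k * a).
Proof.
move=> [fi fa]; split.
  by apply: eq_integrable (integrableZl measurableT k fi).
under eq_integral do rewrite EFinM.
by rewrite integralZl// fa.
Qed.

Lemma has_meanB (d : measure_display) (T : measurableType d) (R : realType)
    (mu : {measure set T -> \bar R}) (f g : T -> R) (a b : R) :
  has_mean mu f a -> has_mean mu g b ->
  has_mean mu (fun t => f t - g t) (a - b).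
Proof.
move=> fa /(has_meanZ (-1))/(has_meanD fa); rewrite mulN1r.
by under eq_fun do rewrite mulN1r.
Qed.

Lemma has_mean0 (d : measure_display) (T : measurableType d) (R : realType)
    (mu : {measure set T -> \bar R}) : has_mean mu (fun=> 0 : R) 0.
Proof. by split; [exact: integrable0|rewrite integral0]. Qed.

Lemma has_mean_cst (d : measure_display) (T : measurableType d) (R : realType)
    (P : probability T R) (k : R) : has_mean P (fun=> k) k.
Proof.
split; first exact: finite_measure_integrable_cst.
by rewrite integral_cst// [X in (_ * X)%E](@probability_setT _ _ _ P) mule1.
Qed.

Lemma has_mean_sum (d : measure_display) (T : measurableType d) (R : realType)
    (mu : {measure set T -> \bar R}) (I : Type) (s : seq I) (f : I -> T -> R)
    (m : I -> R) :
  (forall i, has_mean mu (f i) (m i)) ->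
  has_mean mu (fun t => \sum_(i <- s) f i t) (\sum_(i <- s) m i).
Proof.
move=> fm; elim: s => [|i s IH].
  by under eq_fun do rewrite big_nil; rewrite big_nil; exact: has_mean0.
under eq_fun do rewrite big_cons; rewrite big_cons; exact: has_meanD.
Qed.

Lemma has_mean_unique (d : measure_display) (T : measurableType d)
    (R : realType) (mu : {measure set T -> \bar R}) (f : T -> R) (a b : R) :
  has_mean mu f a -> has_mean mu f b -> a = b.
Proof. by move=> [_ fa] [_ fb]; apply: EFin_inj; rewrite -fa. Qed.

Lemma has_mean_ge0_parts (d : measure_display) (T : measurableType d)
    (R : realType) (mu : {measure set T -> \bar R}) (f : T -> R) (m : R) :
  has_mean mu f m -> exists a b, [/\ has_mean mu (fun t => Num.max (f t) 0) a,
    has_mean mu (fun t => Num.max (- f t) 0) b & m = a - b].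
Proof.
move=> fm; have mf := has_mean_measurable fm; have [fi _] := fm.
have half (g : T -> R) : measurable_fun setT g -> (forall t, `|g t| = `|f t|) ->
    exists a, has_mean mu (fun t => Num.max (g t) 0) a.
  move=> mg gf.
  have gi : mu.-integrable setT (EFin \o (fun t => Num.max (g t) 0)).
    apply: (le_integrable _ _ _ fi) => //.
      by apply/measurable_EFinP; exact: measurable_maxr.
    move=> t _; rewrite lee_fin -gf ger0_norm ?le_max ?lexx ?orbT//.
    by rewrite ge_max ler_norm normr_ge0.
  exists (fine (\int[mu]_t (Num.max (g t) 0)%:E)%E); split => //.
  by rewrite fineK//; exact: integrable_fin_num.
have [a fa] := half f mf (fun=> erefl).
have mNf : measurable_fun setT (fun t => - f t) by exact: measurableT_comp.
have [b fb] := half (fun t => - f t) mNf (fun=> normrN _).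
exists a, b; split=> //; apply: has_mean_unique fm _.
have := has_meanB fa fb; congr has_mean; apply/funext => t.
by have [h|h] := leP 0 (f t); have [h'|h'] := leP 0 (- f t); lra.
Qed.

(** Since [h >= 0], weighting by [h] commutes with taking positive and negative parts, which reduces
    the claim to nonnegative functions. *)
Lemma has_mean_density_pushforward (d d' : measure_display)
    (T : measurableType d) (U : measurableType d') (R : realType)
    (mu : {measure set T -> \bar R}) (nu : {measure set U -> \bar R})
    (X : T -> U) (h : T -> R) (f : U -> R) (m : R) :
  measurable_fun setT X -> measurable_fun setT h -> (forall t, 0 <= h t) ->
  (forall A, measurable A -> \int[mu]_t (h t * \1_A (X t))%:E = nu A)%E ->
  measurable_fun setT f ->
  has_mean mu (fun t => h t * f (X t)) m <-> has_mean nu f m.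
Proof.
move=> mX mh h0 hA.
have ge0P (g : U -> R) a : measurable_fun setT g -> (forall u, 0 <= g u) ->
    has_mean mu (fun t => h t * g (X t)) a <-> has_mean nu g a.
  move=> mg g0; have := ge0_integral_density_pushforward mX mh h0 hA mg g0.
  move=> E; split=> -[_ ga]; apply: ge0_has_mean => //; rewrite -?ga ?E//.
  - by apply: measurable_funM => //; exact: measurableT_comp.
  - by move=> t; rewrite mulr_ge0.
move=> mf; have mNf : measurable_fun setT (fun u => - f u).
  exact: measurableT_comp.
have mf0 : measurable_fun setT (fun u => Num.max (f u) 0).
  exact: measurable_maxr.
have mNf0 : measurable_fun setT (fun u => Num.max (- f u) 0).
  exact: measurable_maxr.
have parts u : f u = Num.max (f u) 0 - Num.max (- f u) 0.
  by have [?|?] := leP 0 (f u); have [?|?] := leP 0 (- f u); lra.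
have max_ge0 (r : R) : 0 <= Num.max r 0 by rewrite le_max lexx orbT.
split=> /has_mean_ge0_parts[a [b [fa fb ->]]].
- have {}fa : has_mean nu (fun u => Num.max (f u) 0) a.
    apply/ge0P => //; move: fa; congr has_mean; apply/funext => t.
    by rewrite maxr_pMr// mulr0.
  have {}fb : has_mean nu (fun u => Num.max (- f u) 0) b.
    apply/ge0P => //; move: fb; congr has_mean; apply/funext => t.
    by rewrite maxr_pMr// mulr0 mulrN.
  have := has_meanB fa fb; congr has_mean; apply/funext => u.
  by rewrite -parts.
- move/ge0P : fa => /(_ mf0 (fun=> max_ge0 _)) fa.
  move/ge0P : fb => /(_ mNf0 (fun=> max_ge0 _)) fb.
  have := has_meanB fa fb; congr has_mean; apply/funext => t.
  by rewrite -mulrBr -parts.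
Qed.

Lemma has_mean_normal_prob (R : realType) (f : R -> R) (m : R) :
  measurable_fun setT f ->
  has_mean (@lebesgue_measure R) (fun x => normal_pdf 0 1 x * f x) m <->
  has_mean (normal_prob (0 : R) 1) f m.
Proof.
move=> mf; apply: (has_mean_density_pushforward m (X := id)) => //.
- exact: measurable_normal_pdf.
- by move=> x; exact: normal_pdf_ge0.
- move=> A mA; rewrite /normal_prob [RHS]integral_mkcond.
  apply: eq_integral => x _; rewrite patchE indicE.
  by case: ifP => _; rewrite ?mulr1 ?mulr0.
Qed.

(** The fundamental theorem of calculus on [[-n, n]] gives [F n - F (- n)], which tends to 0;
    dominated convergence with bound [|f|] identifies the limit with the integral over the line. *)
Lemma has_mean_derive0 (R : realType) (F f : R -> R) :
  (forall x : R, is_derive x (1 : R) F (f x)) -> continuous f ->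
  (@lebesgue_measure R).-integrable setT (EFin \o f) ->
  F n%:R @[n --> \oo] --> (0 : R) -> F (- n%:R) @[n --> \oo] --> (0 : R) ->
  has_mean (@lebesgue_measure R) f 0.
Proof.
move=> dF cf fi F0 FN0; split=> //.
have mf : measurable_fun setT (EFin \o f) by case/integrableP : fi.
pose f_ n := (EFin \o f) \_ `[- n%:R, n%:R]%classic.
have mf_ n : measurable_fun setT (f_ n).
  by apply/(measurable_restrictT _ _).1 => //; exact: measurable_funTS.
have f_f : {ae @lebesgue_measure R, forall x, setT x ->
    f_ ^~ x @ \oo --> (EFin \o f) x}.
  apply/aeW => x _; apply: cvg_near_cst.
  near=> n; rewrite /f_ patchE ifT// inE/= in_itv/= -ler_norml.
  by near: n; exact: nbhs_infty_ger.
have f_le : {ae @lebesgue_measure R, forall x n, setT x ->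
    (`|f_ n x| <= (abse \o (EFin \o f)) x)%E}.
  apply/aeW => x n _; rewrite /f_ patchE; case: ifP => _ //=.
  by rewrite normr0 lee_fin.
have [_ _] := @dominated_convergence _ _ R (@lebesgue_measure R) setT
  measurableT f_ (EFin \o f) _ mf_ mf f_f (integrable_abse fi) f_le.
move=> h; suff h0 : ((\int[lebesgue_measure]_x f_ n x)%E @[n --> \oo] -->
    (0 - 0)%:E).
  by rewrite subr0 in h0; exact: (cvg_unique _ h h0).
have : (F n%:R - F (- n%:R))%:E @[n --> \oo] --> (0 - 0)%:E.
  by apply: cvg_EFin; [exact: nearW|exact: cvgB].
apply: cvg_trans; apply: near_eq_cvg.
near=> n; rewrite /= -integral_mkcond.
have n0 : (- n%:R < n%:R :> R).
  by rewrite gtrN// ltr0n; near: n; exact: nbhs_infty_gt.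
have cF x : {for x, continuous F}.
  by apply: differentiable_continuous; apply/derivable1_diffP; exact: ex_derive.
rewrite (@continuous_FTC2 _ f F)//.
- exact: continuous_subspaceT.
- split; first by move=> x _; exact: ex_derive.
  + by apply: cvg_at_right_filter; exact: cF.
  + by apply: cvg_at_left_filter; exact: cF.
- by move=> x _; rewrite derive1E; exact: derive_val.
Unshelve. all: by end_near. Qed.

(** * Moments of the standard normal distribution *)

Lemma std_normal_pdfE (R : realType) (x : R) :
  normal_pdf 0 1 x = normal_peak 1 * expR (- (x ^+ 2 / 2)).
Proof. by rewrite normal_pdfE ?oner_neq0// /normal_fun subr0 expr1n mulNr. Qed.

Lemma is_derive_std_normal_pdf (R : realType) (x : R) :
  is_derive x (1 : R) (normal_pdf (0 : R) 1) (- (x * normal_pdf 0 1 x)).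
Proof.
rewrite (_ : normal_pdf 0 1 = fun y : R => normal_peak 1 * expR (- (y ^+ 2 / 2))).
  apply: is_derive_eq.
  by rewrite /GRing.scale /=; field.
by apply/funext => y; rewrite std_normal_pdfE.
Qed.

(** The wider Gaussian, of standard deviation 2, supplies an integrable bound for the moments and,
    being bounded itself, decay at infinity. *)
Lemma std_normal_pdf_expr4_le (R : realType) : exists2 C : R, 0 <= C &
  forall x : R, x ^+ 4 * normal_pdf 0 1 x <= C * normal_pdf 0 2 x.
Proof.
have p2 : 0 < normal_peak (2 : R) by rewrite normal_peak_gt0.
(* Split [x^2/2 = 3x^2/8 + x^2/8], the last term being the exponent of the wider density. With
   [t = 3x^2/8], the bound [exp t >= 1 + t^2/2] gives [x^4 <= (128/9) exp t], and [128/9 < 15]. *)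
exists (15 * normal_peak 1 / normal_peak 2) => [|x].
  by rewrite divr_ge0 ?mulr_ge0 ?normal_peak_ge0.
rewrite std_normal_pdfE normal_pdfE// /normal_fun subr0.
rewrite (_ : - (x ^+ 2 / 2) = - (3 * x ^+ 2 / 8) + - x ^+ 2 / (2 ^+ 2 *+ 2));
  last by field.
rewrite expRD; set e := expR (- x ^+ 2 / _).
rewrite [leRHS](_ : _ = 15 * (normal_peak 1 * e)); last by field; rewrite gt_eqF.
rewrite [leLHS](_ : _ =
  x ^+ 4 * expR (- (3 * x ^+ 2 / 8)) * (normal_peak 1 * e)); last by ring.
apply: ler_wpM2r; first by rewrite mulr_ge0 ?normal_peak_ge0 ?expR_ge0.
rewrite expRN ler_pdivrMr ?expR_gt0//.
have := @expR_ge1Dxn R (3 * x ^+ 2 / 8) 1.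
have x2 := sqr_ge0 x; have x4 := sqr_ge0 (x ^+ 2).
move=> /(_ _)/wrap[]; first by lra.
have -> : (2`!)%:R = 2 :> R by [].
move: (expR _) => E; rewrite (_ : x ^+ 4 = x ^+ 2 ^+ 2); last by ring.
move: x4; rewrite !expr2; nra.
Qed.

Lemma integrable_exprn_std_normal_pdf (R : realType) (k : nat) : (k <= 4)%N ->
  (@lebesgue_measure R).-integrable setT
    (EFin \o (fun x => x ^+ k * normal_pdf 0 1 x)).
Proof.
move=> k4; have [C C0 hC] := std_normal_pdf_expr4_le R.
have i1 := integrable_normal_pdf (0 : R) 1.
have i2 := integrableZl measurableT C (integrable_normal_pdf (0 : R) 2).
apply: (le_integrable measurableT _ _ (integrableD measurableT i1 i2)).
  apply/measurable_EFinP/measurable_funM; first exact: measurable_funX.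
  exact: measurable_normal_pdf.
move=> x _ /=; rewrite lee_fin.
have p0 := normal_pdf_ge0 0 1 x; have q0 := normal_pdf_ge0 0 2 x.
rewrite [leRHS]ger0_norm ?addr_ge0 ?mulr_ge0//.
rewrite normrM (ger0_norm p0).
apply: (@le_trans _ _ ((1 + x ^+ 4) * normal_pdf 0 1 x)); last first.
  by rewrite mulrDl mul1r lerD2l.
apply: ler_wpM2r => //.
have -> : x ^+ 4 = `|x| ^+ 4 by rewrite -normrX ger0_norm// (exprM x 2 2) sqr_ge0.
rewrite normrX; have [x1|x1] := leP `|x| 1.
  by rewrite (le_trans (exprn_ile1 k (normr_ge0 x) x1))// lerDl exprn_ge0.
by rewrite (le_trans (ler_weXn2l (ltW x1) k4))// lerDr.
Qed.

Lemma cvg_exprn_std_normal_pdf (R : realType) (k : nat) (s : R) : (k <= 3)%N ->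
  `|s| = 1 ->
  (s * n%:R) ^+ k * normal_pdf 0 1 (s * n%:R) @[n --> \oo] --> (0 : R).
Proof.
move=> k3 s1; have [C C0 hC] := std_normal_pdf_expr4_le R.
have p0 : 0 <= C * normal_peak 2 by rewrite mulr_ge0 ?normal_peak_ge0.
apply/norm_cvg0P.
(* The bound on the fourth power leaves a factor [1/n] to spare when [k <= 3]; it is at most
   [2/(n+1)] for [n >= 1], which brings in the harmonic sequence. *)
have h : C * normal_peak 2 * (n.+1%:R^-1 * 2) @[n --> \oo] --> (0 : R).
  rewrite -[X in _ --> X](mulr0 (C * normal_peak 2)); apply: cvgMr.
  by rewrite -[X in _ --> X](mul0r 2); apply: cvgMl; exact: cvg_harmonic.
apply: (squeeze_cvgr _ (cvg_cst 0) h); near=> n; rewrite normr_ge0/=.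
have n1 : 1 <= n%:R :> R by rewrite ler1n; near: n; exact: nbhs_infty_gt.
set x := s * n%:R; have nx : `|x| = n%:R by rewrite normrM s1 mul1r normr_nat.
have pos := normal_pdf_ge0 0 1 x.
rewrite normrM (ger0_norm pos) normrX nx.
have h1 : n%:R ^+ 4 * normal_pdf 0 1 x <= C * normal_peak 2.
  have -> : n%:R ^+ 4 = x ^+ 4 by rewrite -nx -normrX ger0_norm// (exprM x 2 2) sqr_ge0.
  by apply: le_trans (hC x) _; rewrite ler_wpM2l// normal_pdf_ub.
apply: (@le_trans _ _ (C * normal_peak 2 * n%:R^-1)); last first.
  rewrite ler_wpM2l// mulrC ler_pdivlMr ?ltr0Sn// mulrC.
  by rewrite ler_pdivrMr ?(lt_le_trans ltr01 n1)// -natr1; lra.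
rewrite ler_pdivlMr ?(lt_le_trans ltr01 n1)//; apply: le_trans h1.
rewrite mulrAC -exprSr ler_wpM2r//.
by rewrite ler_weXn2l.
Unshelve. all: by end_near. Qed.

(* Stein's identity [E (X f X) = E (f' X)] for [f = x^k]: the function
   [- x^k phi(x)] vanishes at infinity. *)
Lemma normal_prob_moment_rec (R : realType) (k : nat) (m : R) : (k <= 3)%N ->
  has_mean (normal_prob (0 : R) 1) (fun x => x ^+ k.-1) m ->
  has_mean (normal_prob (0 : R) 1) (fun x => x ^+ k.+1) (k%:R * m).
Proof.
move=> k3 /has_mean_normal_prob hm.
have mX j : measurable_fun setT (fun x : R => x ^+ j) by exact: measurable_funX.
apply/has_mean_normal_prob => //.
pose phi := normal_pdf (0 : R) 1.
have h0 : has_mean (@lebesgue_measure R)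
    (fun x => phi x * x ^+ k.+1 - k%:R * (phi x * x ^+ k.-1)) 0.
  apply: (@has_mean_derive0 _ (fun x => - (x ^+ k * phi x))).
  - move=> x; have dphi := is_derive_std_normal_pdf x.
    have dX : is_derive x (1 : R) (fun y : R => y ^+ k) (k%:R * x ^+ k.-1).
      have := @is_deriveX R R id k x 1 1 (is_derive_id _ _).
      by rewrite fctE /GRing.scale /= mulr1.
    apply: is_derive_eq; rewrite /GRing.scale/= -/phi exprS; ring.
  - move=> x; have cphi := @continuous_normal_pdf R 0 1 (oner_neq0 _) x.
    apply: cvgB; last apply: cvgMr; apply: cvgM => //; exact: exprn_continuous.
  - have i1 := @integrable_exprn_std_normal_pdf R k.+1 k3.
    have i2 := integrableZl measurableT k%:R
      (@integrable_exprn_std_normal_pdf R k.-1 (leq_trans (leq_pred _) (leqW k3))).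
    apply: eq_integrable (integrableB measurableT i1 i2) => // x _.
    by rewrite /= !(mulrC (phi x)).
  - rewrite -[X in _ --> X]oppr0; apply: cvgN.
    have := @cvg_exprn_std_normal_pdf R k 1 k3 (normr1 _).
    by under eq_fun do rewrite mul1r.
  - rewrite -[X in _ --> X]oppr0; apply: cvgN.
    have := @cvg_exprn_std_normal_pdf R k (-1) k3 (normrN1 _).
    by under eq_fun do rewrite mulN1r.
have := has_meanD h0 (has_meanZ k%:R (hm (mX _))).
rewrite add0r; congr has_mean; apply/funext => x; rewrite /phi; ring.
Qed.

Lemma normal_prob_moments (R : realType) :
  [/\ has_mean (normal_prob (0 : R) 1) (fun x => x ^+ 1) 0,
      has_mean (normal_prob (0 : R) 1) (fun x => x ^+ 2) 1,
      has_mean (normal_prob (0 : R) 1) (fun x => x ^+ 3) 0 &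
      has_mean (normal_prob (0 : R) 1) (fun x => x ^+ 4) 3].
Proof.
have m0 : has_mean (normal_prob (0 : R) 1) (fun x => x ^+ 0) 1.
  under eq_fun do rewrite expr0; exact: has_mean_cst.
(* For [k = 0] the predecessor is again 0, and the factor 0 gives the vanishing first moment. *)
have m1 := @normal_prob_moment_rec R 0 1 isT m0; rewrite mul0r in m1.
have m2 := @normal_prob_moment_rec R 1 1 isT m0; rewrite mulr1 in m2.
have m3 := @normal_prob_moment_rec R 2 0 isT m1; rewrite mulr0 in m3.
have m4 := @normal_prob_moment_rec R 3 1 isT m2; rewrite mulr1 in m4.
by split.
Qed.

(** * Independence and Gaussian linear forms *)

Lemma has_mean_std_normal (d : measure_display) (T : measurableType d)
    (R : realType) (P : probability T R) (X : T -> R) (f : R -> R) (m : R) :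
  std_normal_rv P X -> has_mean (normal_prob (0 : R) 1) f m ->
  has_mean P (f \o X) m.
Proof.
move=> [mX dX] fm; have mf := has_mean_measurable fm.
suff : has_mean P (fun t => 1 * f (X t)) m by under eq_fun do rewrite mul1r.
apply: (iffRL (has_mean_density_pushforward (nu := normal_prob (0 : R) 1)
  (h := fun=> 1) m mX _ _ _ mf)) fm => // A mA.
under eq_integral do rewrite mul1r.
rewrite [LHS](_ : _ = \int[P]_t (\1_(X @^-1` A) t)%:E)%E//.
rewrite integral_indic// ?setIT; first exact: dX.
by rewrite -[X @^-1` A]setTI; exact: mX.
Qed.

Lemma independent_indic_prod (d : measure_display) (T : measurableType d)
    (R : realType) (P : probability T R) (I : finType) (X : I -> T -> R)
    (A : I -> set R) (m : I -> R) :
  mutually_independent P X -> (forall i, measurable (A i)) ->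
  (forall i, has_mean P (fun t => \1_(A i) (X i t)) (m i)) ->
  has_mean P (fun t => \prod_i \1_(A i) (X i t)) (\prod_i m i).
Proof.
move=> [mX ind] mA Am.
have mXA i : measurable (X i @^-1` A i).
  by rewrite -[_ @^-1` _]setTI; exact: mX.
have mB : measurable (\bigcap_(i in [set: I]) (X i @^-1` A i)).
  by apply: fin_bigcap_measurable.
rewrite (_ : (fun t => _) = \1_(\bigcap_(i in [set: I]) (X i @^-1` A i))).
  apply: ge0_has_mean => //.
  rewrite integral_indic// setIT -[LHS]fineK ?fin_num_measure// ind//.
  congr EFin; apply: eq_bigr => i _; apply: EFin_inj.
  have [_ <-] := Am i; rewrite fineK ?fin_num_measure//.
  rewrite [RHS](_ : _ = \int[P]_t (\1_(X i @^-1` A i) t)%:E)%E//.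
  by rewrite integral_indic// setIT.
apply/funext => t; rewrite [RHS]indicE; case: (boolP (t \in _)) => [/set_mem h|h].
  by rewrite big1// => i _; rewrite indicE mem_set//; exact: h.
have [i Xi] : exists i, ~ A i (X i t).
  apply/existsNP => tA; apply: (negP h); rewrite inE => i _; exact: tA.
by rewrite (bigD1 i)//= indicE memNset// mul0r.
Qed.

(* Induction on the set of indices [i] at which [f i] is allowed to be other than
   an indicator; the product of the remaining factors serves as a density. *)
Lemma independent_ge0_prod (d : measure_display) (T : measurableType d)
    (R : realType) (P : probability T R) (I : finType) (X : I -> T -> R)
    (f : I -> R -> R) (m : I -> R) :
  mutually_independent P X -> (forall i, measurable_fun setT (f i)) ->
  (forall i x, 0 <= f i x) -> (forall i, has_mean P (f i \o X i) (m i)) ->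
  has_mean P (fun t => \prod_i f i (X i t)) (\prod_i m i).
Proof.
move=> ind.
have [mX _] := ind.
suff gen (s : seq I) : forall (f : I -> R -> R) (m : I -> R),
    (forall i, measurable_fun setT (f i)) ->
    (forall i x, 0 <= f i x) -> (forall i, has_mean P (f i \o X i) (m i)) ->
    (forall i, i \notin s -> exists2 A, measurable A & f i = \1_A) ->
    has_mean P (fun t => \prod_i f i (X i t)) (\prod_i m i).
  by move=> mf f0 fm; apply: (gen (enum I)) => // i; rewrite mem_enum.
elim: s => [|i0 s IH] {}f {}m mf f0 fm fs.
  have /choice[A hA] : forall i, exists A, measurable A /\ f i = \1_A.
    by move=> i; have [A mA fA] := fs i isT; exists A.
  under eq_fun do under eq_bigr do rewrite (hA _).2.
  apply: independent_indic_prod => // i; first exact: (hA i).1.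
  by rewrite -(hA i).2; exact: fm.
pose h t := \prod_(i | i != i0) f i (X i t).
pose C := \prod_(i | i != i0) m i.
have mh : measurable_fun setT h.
  under [h]eq_fun do rewrite big_mkcond.
  apply: measurable_prod => i _; case: (i != i0); last exact: measurable_cst.
  exact: measurableT_comp.
have h0 t : 0 <= h t by apply: prodr_ge0.
have C0 : 0 <= C.
  apply: prodr_ge0 => i _; rewrite -lee_fin; have [_ <-] := fm i.
  by apply: integral_ge0 => t _; rewrite lee_fin; exact: f0.
(* With [\1_A] as the factor at [i0] the induction hypothesis applies: the law of [X i0] weighted by
   [h] is [C] times its law. *)
have hA A : measurable A -> has_mean P (fun t => h t * \1_A (X i0 t))
    (C * fine (P (X i0 @^-1` A))).
  move=> mA.
  pose f' i := if i == i0 then \1_A else f i.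
  pose m' i := if i == i0 then fine (P (X i0 @^-1` A)) else m i.
  have : has_mean P (fun t => \prod_i f' i (X i t)) (\prod_i m' i); last first.
    congr has_mean; first (apply/funext => t); rewrite (bigD1 i0)//= mulrC;
      congr (_ * _); rewrite ?/f' ?/m' ?eqxx//;
      by apply: eq_bigr => i /negPf ->.
  apply: IH.
  - by move=> i; rewrite /f'; case: ifP => // _; exact: measurable_indic.
  - by move=> i x; rewrite /f'; case: ifP.
  - move=> i; rewrite /f' /m'; case: eqVneq => [->|//].
    have mXA : measurable (X i0 @^-1` A).
      by rewrite -[_ @^-1` _]setTI; exact: mX.
    apply: ge0_has_mean => //.
      by apply: measurableT_comp => //; exact: measurable_indic.
    rewrite [LHS](_ : _ = \int[P]_t (\1_(X i0 @^-1` A) t)%:E)%E//.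
    by rewrite integral_indic// setIT fineK ?fin_num_measure.
  - move=> i is'; rewrite /f'; case: ifP => [_|/negbT ii0]; first by exists A.
    by apply: fs; rewrite inE negb_or ii0.
pose X0 : {mfun T >-> R} :=
  HB.pack (X i0) (isMeasurableFun.Build _ _ _ _ _ (mX i0)).
pose nu := mscale (NngNum C0) (distribution P X0).
rewrite (bigD1 i0)//= -/C.
rewrite (_ : (fun t => _) = (fun t => h t * f i0 (X i0 t))); last first.
  by apply/funext => t; rewrite (bigD1 i0)//= mulrC.
apply: ge0_has_mean.
- by apply: measurable_funM => //; exact: measurableT_comp.
- by move=> t; rewrite mulr_ge0.
rewrite (ge0_integral_density_pushforward (nu := nu) (mX i0) mh h0)//.
  have mf0 : measurable_fun setT (EFin \o f i0) by exact/measurable_EFinP.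
  rewrite ge0_integral_mscale//; last by move=> x _; rewrite lee_fin.
  rewrite (ge0_integral_distribution X0 mf0); last by move=> x; rewrite lee_fin.
  by rewrite mulrC EFinM; congr (_ * _)%E; have [_] := fm i0.
move=> A mA; have [_ ->] := hA A mA.
rewrite EFinM fineK ?fin_num_measure//.
by rewrite -[_ @^-1` _]setTI; apply: (mX i0).
Qed.

(* Reduction to nonnegative factors by [f = f^+ - f^-], one index at a time. *)
Lemma independent_prod (d : measure_display) (T : measurableType d)
    (R : realType) (P : probability T R) (I : finType) (X : I -> T -> R)
    (f : I -> R -> R) (m : I -> R) :
  mutually_independent P X -> (forall i, measurable_fun setT (f i)) ->
  (forall i, has_mean P (f i \o X i) (m i)) ->
  has_mean P (fun t => \prod_i f i (X i t)) (\prod_i m i).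
Proof.
move=> ind.
suff gen (s : seq I) : forall (f : I -> R -> R) (m : I -> R),
    (forall i, measurable_fun setT (f i)) ->
    (forall i, has_mean P (f i \o X i) (m i)) ->
    (forall i, i \notin s -> forall x, 0 <= f i x) ->
    has_mean P (fun t => \prod_i f i (X i t)) (\prod_i m i).
  by move=> mf fm; apply: (gen (enum I)) => // i; rewrite mem_enum.
elim: s => [|i0 s IH] {}f {}m mf fm fs.
  by apply: independent_ge0_prod => // i; exact: fs.
have [a [b [fa fb mab]]] := has_mean_ge0_parts (fm i0).
have step (g : R -> R) (c : R) : measurable_fun setT g -> (forall x, 0 <= g x) ->
    has_mean P (g \o X i0) c ->
    has_mean P (fun t => g (X i0 t) * \prod_(i | i != i0) f i (X i t))
               (c * \prod_(i | i != i0) m i).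
  move=> mg g0 gc.
  pose f' i := if i == i0 then g else f i.
  pose m' i := if i == i0 then c else m i.
  have : has_mean P (fun t => \prod_i f' i (X i t)) (\prod_i m' i); last first.
    congr has_mean; first (apply/funext => t); rewrite (bigD1 i0)//=;
      congr (_ * _); rewrite ?/f' ?/m' ?eqxx//;
      by apply: eq_bigr => i /negPf ->.
  apply: IH.
  - by move=> i; rewrite /f'; case: ifP.
  - by move=> i; rewrite /f' /m'; case: eqVneq => [->|].
  - move=> i si x; rewrite /f'; case: ifP => [//|/negbT ii0].
    by apply: fs; rewrite inE negb_or ii0.
have max_ge0 (r : R) : 0 <= Num.max r 0 by rewrite le_max lexx orbT.
have ha := step (fun x => Num.max (f i0 x) 0) a _ _ fa.
have hb := step (fun x => Num.max (- f i0 x) 0) b _ _ fb.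
have mN : measurable_fun setT (fun x => - f i0 x) by exact: measurableT_comp.
have := has_meanB (ha (measurable_maxr (mf i0) (measurable_cst _)) (fun=> max_ge0 _))
  (hb (measurable_maxr mN (measurable_cst _)) (fun=> max_ge0 _)).
congr has_mean; last by rewrite [RHS](bigD1 i0)//= mab mulrBl.
apply/funext => t.
rewrite -mulrBl [RHS](bigD1 i0)//=; congr (_ * _).
by have [?|?] := leP 0 (f i0 (X i0 t)); have [?|?] := leP 0 (- f i0 (X i0 t)); lra.
Qed.

(** The moments of orders 0 to 4 of the standard normal law; the default value beyond order 4 is not
    meant as a moment. *)
Definition normal_moment (R : realType) (k : nat) : R :=
  nth 0 [:: 1; 0; 1; 0; 3] k.

Lemma gaussian_monomial (d : measure_display) (T : measurableType d)
    (R : realType) (P : probability T R) (I : finType) (X : I -> T -> R)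
    (a : I -> nat) :
  mutually_independent P X -> (forall i, std_normal_rv P (X i)) ->
  (forall i, (a i <= 4)%N) ->
  has_mean P (fun t => \prod_i X i t ^+ a i) (\prod_i normal_moment R (a i)).
Proof.
move=> ind nX a4.
apply: (independent_prod (f := fun i x => x ^+ a i)) => // i.
apply: has_mean_std_normal => //.
have [m1 m2 m3 m4] := normal_prob_moments R.
have m0 : has_mean (normal_prob (0 : R) 1) (fun x => x ^+ 0) 1.
  under eq_fun do rewrite expr0; exact: has_mean_cst.
by have := a4 i; case: (a i) => [|[|[|[|[|]]]]].
Qed.

(** Writes one coordinate as a monomial, so that a product of coordinates becomes a monomial whose
    exponents count repetitions. *)
Lemma prodX_delta (R : realType) (I : finType) (x : I -> R) (i : I) :
  \prod_r x r ^+ (r == i) = x i.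
Proof.
by rewrite (bigD1 i)//= eqxx big1 ?mulr1// => r /negPf ->.
Qed.

Lemma normal_moment_prod_odd (R : realType) (I : finType) (a : I -> nat) (i : I) :
  (a i <= 4)%N -> odd (a i) -> \prod_r normal_moment R (a r) = 0.
Proof.
by move=> ai oi; rewrite (bigD1 i)//=; case: (a i) ai oi => [|[|[|[|[|]]]]]//;
  rewrite mul0r.
Qed.

Lemma gaussian_mean2 (d : measure_display) (T : measurableType d)
    (R : realType) (P : probability T R) (I : finType) (X : I -> T -> R)
    (i j : I) :
  mutually_independent P X -> (forall i, std_normal_rv P (X i)) ->
  has_mean P (fun t => X i t * X j t) (i == j)%:R.
Proof.
move=> ind nX; pose a r := ((r == i) + (r == j))%N.
have a2 r : (a r <= 2)%N by rewrite /a; do 2 case: (r == _).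
have := gaussian_monomial ind nX (fun r => leq_trans (a2 r) (isT : 2 <= 4)%N).
congr has_mean; first apply/funext => t.
  by rewrite /a; under eq_bigr do rewrite exprD; rewrite big_split/= !prodX_delta.
have [ij|ij] := eqVneq i j.
  by subst j; rewrite (bigD1 i)//= /a eqxx big1 ?mulr1// => r /negPf ->.
by rewrite (@normal_moment_prod_odd _ _ _ i)// /a ?eqxx ?(negPf ij).
Qed.

Lemma gaussian_mean4 (d : measure_display) (T : measurableType d)
    (R : realType) (P : probability T R) (I : finType) (X : I -> T -> R)
    (i j k l : I) :
  mutually_independent P X -> (forall i, std_normal_rv P (X i)) ->
  has_mean P (fun t => X i t * (X j t * (X k t * X l t)))
    ((i == j)%:R * (k == l)%:R + (i == k)%:R * (j == l)%:R
     + (i == l)%:R * (j == k)%:R).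
Proof.
(* [a r] is the multiplicity of [r] among the four indices. Four equal indices give 3, two distinct
   pairs give 1, and every other pattern has an index of odd multiplicity, hence mean 0. *)
move=> ind nX; pose a r := ((r == i) + ((r == j) + ((r == k) + (r == l))))%N.
have a4 r : (a r <= 4)%N by rewrite /a; do 4 case: (r == _).
have := gaussian_monomial ind nX a4.
congr has_mean; first apply/funext => t.
  rewrite /a; under eq_bigr do rewrite !exprD.
  by rewrite !big_split/= !prodX_delta.
have pair r s : r != s -> (forall q, a q = 2 * (q == r) + 2 * (q == s))%N ->
    \prod_q normal_moment R (a q) = 1.
  move=> rs aE; rewrite (bigD1 r)//= (bigD1 s) 1?eq_sym//= !aE !eqxx.
  rewrite (negPf rs) eq_sym (negPf rs) !mul1r big1// => q /andP[/negPf qr /negPf qs].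
  by rewrite aE qr qs.
have [ij|ij] := eqVneq i j; have [kl|kl] := eqVneq k l.
- subst j l; have [ik|ik] := eqVneq i k.
    subst k; rewrite (bigD1 i)//= /a eqxx big1 => [|r /negPf ->//].
    by rewrite /normal_moment/=; ring.
  rewrite (pair i k ik) => [|q]; first by rewrite /= ?(mulr1n, mulr0n); ring.
  by rewrite /a; lia.
- subst j; rewrite (@normal_moment_prod_odd _ _ _ k)//.
    have [ik|ik] := eqVneq i k; last by rewrite /= ?(mulr1n, mulr0n); ring.
    by rewrite -ik in kl; rewrite (negPf kl) /= !mulr0n; ring.
  by rewrite /a eqxx (negPf kl); case: (k == i).
- subst l; rewrite (@normal_moment_prod_odd _ _ _ i)//.
    have [ik|ik] := eqVneq i k; last by rewrite /= ?(mulr1n, mulr0n); ring.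
    by rewrite -ik eq_sym (negPf ij) /= !mulr0n; ring.
  by rewrite /a eqxx (negPf ij); case: (i == k).
- have [ik|ik] := eqVneq i k.
    subst k; rewrite (negPf kl); have [jl|jl] := eqVneq j l.
      subst l; rewrite (pair i j ij) => [|q]; first by rewrite /= ?(mulr1n, mulr0n); ring.
      by rewrite /a; lia.
    rewrite (@normal_moment_prod_odd _ _ _ j)//;
      first by rewrite /= ?(mulr1n, mulr0n); ring.
    by rewrite /a eqxx (negPf jl) eq_sym (negPf ij).
  have [il|il] := eqVneq i l.
    subst l; have [jk|jk] := eqVneq j k.
      subst k; rewrite (pair i j ij) => [|q]; first by rewrite /= ?(mulr1n, mulr0n); ring.
      by rewrite /a; lia.
    rewrite (@normal_moment_prod_odd _ _ _ j)//;
      first by rewrite /= ?(mulr1n, mulr0n); ring.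
    by rewrite /a eqxx (negPf jk) eq_sym (negPf ij).
  rewrite (@normal_moment_prod_odd _ _ _ i)//;
      first by rewrite /= ?(mulr1n, mulr0n); ring.
  by rewrite /a eqxx (negPf ij) (negPf ik) (negPf il).
Qed.

Definition lin_form (R : realType) (T : Type) (I : finType) (X : I -> T -> R)
  (a : I -> R) (t : T) : R := \sum_i a i * X i t.

Definition dotf (R : realType) (I : finType) (a b : I -> R) : R :=
  \sum_i a i * b i.

Lemma dotf_delta (R : realType) (I : finType) (a : I -> R) (j : I) :
  \sum_i a i * (i == j)%:R = a j.
Proof.
by rewrite (bigD1 j)//= eqxx mulr1 big1 ?addr0// => i /negPf ->; rewrite mulr0.
Qed.

(** Linearity in one factor with the rest [g] held fixed; iterating it passes from coordinates to
    linear forms factor by factor. *)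
Lemma has_mean_lin_form (d : measure_display) (T : measurableType d)
    (R : realType) (P : probability T R) (I : finType) (X : I -> T -> R)
    (a : I -> R) (g : T -> R) (e : I -> R) (m : R) :
  (forall i, has_mean P (fun t => X i t * g t) (e i)) ->
  \sum_i a i * e i = m ->
  has_mean P (fun t => lin_form X a t * g t) m.
Proof.
move=> Xe <-.
have := has_mean_sum (index_enum I) (fun i => has_meanZ (a i) (Xe i)).
congr has_mean; apply/funext => t; rewrite /lin_form mulr_suml.
by apply: eq_bigr => i _; rewrite mulrA.
Qed.

Lemma lin_form_mean2 (d : measure_display) (T : measurableType d)
    (R : realType) (P : probability T R) (I : finType) (X : I -> T -> R)
    (a b : I -> R) :
  mutually_independent P X -> (forall i, std_normal_rv P (X i)) ->
  has_mean P (fun t => lin_form X a t * lin_form X b t) (dotf a b).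
Proof.
move=> ind nX; apply: has_mean_lin_form => // i.
under eq_fun do rewrite mulrC.
apply: has_mean_lin_form => [j|]; first exact: gaussian_mean2.
exact: dotf_delta.
Qed.

Lemma lin_form_mean4 (d : measure_display) (T : measurableType d)
    (R : realType) (P : probability T R) (I : finType) (X : I -> T -> R)
    (a b c e : I -> R) :
  mutually_independent P X -> (forall i, std_normal_rv P (X i)) ->
  has_mean P (fun t => lin_form X a t *
      (lin_form X b t * (lin_form X c t * lin_form X e t)))
    (dotf a b * dotf c e + dotf a c * dotf b e + dotf a e * dotf b c).
Proof.
move=> ind nX.
have sum3 (x u v w : I -> R) (p q r : R) :
    \sum_i x i * (u i * p + v i * q + w i * r) =
    dotf x u * p + dotf x v * q + dotf x w * r.
  rewrite /dotf !mulr_suml -!big_split/=.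
  by apply: eq_bigr => i _; ring.
(* One coordinate is replaced at a time, in the order [a], [b], [c], [e]; the reorderings by [ring]
   bring the next coordinate to the front. *)
have h1 j k l : has_mean P (fun t => lin_form X a t * (X j t * (X k t * X l t)))
    (a j * (k == l)%:R + a k * (j == l)%:R + a l * (j == k)%:R).
  apply: has_mean_lin_form => [i|]; first exact: gaussian_mean4.
  by rewrite sum3 /dotf !dotf_delta.
have h2 k l : has_mean P (fun t => lin_form X b t * (lin_form X a t * (X k t * X l t)))
    (dotf b a * (k == l)%:R + b l * a k + b k * a l).
  apply: has_mean_lin_form => [j|].
    have := h1 j k l; congr has_mean; apply/funext => t; ring.
  under eq_bigr do rewrite [X in _ + X + _]mulrC [X in _ + _ + X]mulrC.
  by rewrite sum3 /dotf !dotf_delta.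
have h3 l : has_mean P (fun t => lin_form X c t *
      (lin_form X b t * (lin_form X a t * X l t)))
    (dotf b a * c l + b l * dotf c a + dotf c b * a l).
  apply: has_mean_lin_form => [k|].
    have := h2 k l; congr has_mean; apply/funext => t; ring.
  rewrite (eq_bigr (fun k => c k * ((k == l)%:R * dotf b a + a k * b l + b k * a l))).
    by rewrite sum3 /dotf !dotf_delta; ring.
  by move=> k _; ring.
have : has_mean P (fun t => lin_form X e t *
      (lin_form X c t * (lin_form X b t * lin_form X a t)))
    (dotf a b * dotf c e + dotf a c * dotf b e + dotf a e * dotf b c).
  apply: has_mean_lin_form => [l|].
    have := h3 l; congr has_mean; apply/funext => t; ring.
  rewrite (eq_bigr (fun l => e l * (c l * dotf b a + b l * dotf c a + a l * dotf c b))).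
    have dotC (x y : I -> R) : dotf x y = dotf y x.
      by apply: eq_bigr => i _; rewrite mulrC.
    by rewrite sum3 (dotC b a) (dotC c a) (dotC c b) !(dotC e); ring.
  by move=> l _; ring.
by congr has_mean; apply/funext => t; ring.
Qed.

(** The variance of [s] times a chi-square variable with [p] degrees of freedom, from moments alone:
    the second moment is the double sum of [s^2 + 2 s^2 (j == k)], that is [p^2 s^2 + 2 p s^2]. *)
Lemma lin_form_sqnorm_variance (d : measure_display) (T : measurableType d)
    (R : realType) (P : probability T R) (I : finType) (X : I -> T -> R)
    (p : nat) (a : 'I_p -> I -> R) (s : R) :
  mutually_independent P X -> (forall i, std_normal_rv P (X i)) ->
  (forall j k, dotf (a j) (a k) = s * (j == k)%:R) ->
  has_mean P (fun t => (\sum_j lin_form X (a j) t ^+ 2 - p%:R * s) ^+ 2)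
    (2 * p%:R * s ^+ 2).
Proof.
move=> ind nX aa.
have m2 : has_mean P (fun t => \sum_j lin_form X (a j) t ^+ 2) (p%:R * s).
  have := has_mean_sum (index_enum 'I_p)
    (fun j => lin_form_mean2 (a j) (a j) ind nX).
  congr has_mean.
  rewrite (eq_bigr (fun=> s)) => [|j _]; last by rewrite aa eqxx mulr1.
  by rewrite sumr_const card_ord mulr_natl.
have m4 : has_mean P (fun t => (\sum_j lin_form X (a j) t ^+ 2) ^+ 2)
    (p%:R ^+ 2 * s ^+ 2 + 2 * p%:R * s ^+ 2).
  have := has_mean_sum (index_enum 'I_p) (fun j =>
    has_mean_sum (index_enum 'I_p) (fun k =>
    lin_form_mean4 (a j) (a j) (a k) (a k) ind nX)).
  congr has_mean.
    apply/funext => t; rewrite expr2 mulr_suml; apply: eq_bigr => j _.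
    by rewrite mulr_sumr; apply: eq_bigr => k _; ring.
  transitivity (\sum_(j < p) \sum_(k < p) (s ^+ 2 + 2 * s ^+ 2 * (k == j)%:R)).
    apply: eq_bigr => j _; apply: eq_bigr => k _; rewrite !aa !eqxx (eq_sym j).
    by case: (k == j) => /=; ring.
  under eq_bigr do rewrite big_split/= dotf_delta sumr_const card_ord -mulr_natl.
  by rewrite sumr_const card_ord -mulr_natl; ring.
have := has_meanD (has_meanB m4 (has_meanZ (2 * (p%:R * s)) m2))
  (has_mean_cst P ((p%:R * s) ^+ 2)).
by congr has_mean; [apply/funext => t|]; ring.
Qed.

(** * Convergence in probability *)

Lemma has_mean_le (d : measure_display) (T : measurableType d) (R : realType)
    (mu : {measure set T -> \bar R}) (f g : T -> R) (a b : R) :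
  has_mean mu f a -> has_mean mu g b -> (forall t, f t <= g t) -> a <= b.
Proof.
move=> [fi fa] [gi gb] fg; rewrite -lee_fin -fa -gb.
by apply: le_integral => // t _; rewrite lee_fin.
Qed.

Lemma has_mean_indic (d : measure_display) (T : measurableType d)
    (R : realType) (P : probability T R) (A : set T) :
  measurable A -> has_mean P \1_A (fine (P A)).
Proof.
move=> mA; apply: ge0_has_mean => //.
by rewrite integral_indic// setIT fineK// fin_num_measure.
Qed.

Lemma bounded_has_mean (d : measure_display) (T : measurableType d)
    (R : realType) (P : probability T R) (f : T -> R) :
  measurable_fun setT f -> (forall t, 0 <= f t <= 1) ->
  exists m, has_mean P f m.
Proof.
move=> mf f01; have [i1 _] := has_mean_cst P 1.
have fi : P.-integrable setT (EFin \o f).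
  apply: (le_integrable measurableT _ _ i1); first exact/measurable_EFinP.
  by move=> t _; have /andP[f0 f1] := f01 t; rewrite lee_fin normr1 ger0_norm.
exists (fine (\int[P]_t (f t)%:E)%E); split => //.
by rewrite fineK//; exact: integrable_fin_num.
Qed.

Lemma Phi_ge0 (R : realType) (x : R) : 0 <= Phi x.
Proof. by rewrite fine_ge0. Qed.

Lemma Phi_le1 (R : realType) (x : R) : Phi x <= 1.
Proof.
by rewrite -lee_fin fineK ?fin_num_measure//; exact: probability_le1.
Qed.

(** The mass of []x, y]] is at most its length times the peak of the density. Monotonicity gives
    measurability of [Phi], and both bounds together its continuity. *)
Lemma Phi_le_lipschitz (R : realType) (x y : R) : x <= y ->
  Phi x <= Phi y <= Phi x + normal_peak 1 * (y - x).
Proof.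
move=> xy.
have fN (A : set R) : measurable A -> normal_prob (0 : R) 1 A \is a fin_num.
  by move=> mA; exact: fin_num_measure.
apply/andP; split.
  rewrite /Phi fine_le ?fN// le_measure ?inE//.
  by apply: subset_itvl; rewrite bnd_simp.
have U : `]-oo, y]%classic = `]-oo, x]%classic `|` `]x, y]%classic.
  by rewrite -itv_bndbnd_setU// bnd_simp.
rewrite /Phi U measureU//; last first.
  apply/seteqP; split => // z []/=; rewrite !in_itv/= => zx /andP[xz _].
  by have := lt_le_trans xz zx; rewrite ltxx.
rewrite fineD ?fN// lerD2l -lee_fin fineK ?fN//.
rewrite /normal_prob.
apply: (@le_trans _ _ (\int[lebesgue_measure]_(z in `]x, y]) (normal_peak 1)%:E)%E).
  apply: ge0_le_integral => //.
  - by move=> z _; rewrite lee_fin normal_pdf_ge0.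
  - by apply/measurable_funTS/measurable_EFinP; exact: measurable_normal_pdf.
  - by move=> z _; rewrite lee_fin normal_pdf_ub.
rewrite integral_cst//= lebesgue_measure_itv/= lte_fin.
by case: ltrP => xy'; rewrite ?mule0 -?EFinD -?EFinM lee_fin// mulr_ge0
  ?normal_peak_ge0// subr_ge0.
Qed.

Lemma continuous_Phi (R : realType) : continuous (@Phi R).
Proof.
have p0 : 0 < normal_peak (1 : R) by rewrite normal_peak_gt0.
move=> x; apply/cvgrPdist_le => e e0.
exists (e / normal_peak 1) => /= [|y /ltW]; first exact: divr_gt0.
rewrite ler_pdivlMr// mulrC; apply: le_trans.
have [xy|/ltW yx] := leP x y.
  have /andP[h1 h2] := Phi_le_lipschitz xy.
  by rewrite distrC (distrC x) !ger0_norm ?subr_ge0// lerBlDl.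
have /andP[h1 h2] := Phi_le_lipschitz yx.
by rewrite !ger0_norm ?subr_ge0// lerBlDl.
Qed.

Lemma measurable_Phi (R : realType) : measurable_fun setT (@Phi R).
Proof.
by apply: nondecreasing_measurable => // x y /Phi_le_lipschitz/andP[].
Qed.

(* The event [X p t \in A] is measured through an inner approximation [B], which
   makes the continuous mapping lemma [cvg_prob_comp] immediate. *)
Definition cvg_prob (R : realType) (d : measure_display)
    (Omega : nat -> measurableType d) (P : forall p, probability (Omega p) R)
    (V : topologicalType) (X : forall p, Omega p -> V) (l : V) : Prop :=
  forall A, nbhs l A -> forall e : R, 0 < e -> \forall p \near \oo,
    exists B : set (Omega p),
      [/\ measurable B, forall t, B t -> A (X p t) & (P p (~` B) <= e%:E)%E].

Lemma cvg_prob_seq (R : realType) (d : measure_display)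
    (Omega : nat -> measurableType d) (P : forall p, probability (Omega p) R)
    (V : topologicalType) (a : nat -> V) (l : V) :
  a @ \oo --> l -> cvg_prob P (fun p _ => a p) l.
Proof.
move=> al A Al e e0; near=> p; exists setT; split => //.
  by move=> t _; near: p; exact: al.
by rewrite setCT measure0 lee_fin ltW.
Unshelve. all: by end_near. Qed.

Lemma cvg_prob_pair (R : realType) (d : measure_display)
    (Omega : nat -> measurableType d) (P : forall p, probability (Omega p) R)
    (V W : topologicalType) (X : forall p, Omega p -> V)
    (Y : forall p, Omega p -> W) (l : V) (k : W) :
  cvg_prob P X l -> cvg_prob P Y k ->
  cvg_prob P (fun p t => (X p t, Y p t)) (l, k).
Proof.
move=> Xl Yk A [[A1 A2] /= [A1l A2k] A12] e e0.
have e2 : 0 < e / 2 by rewrite divr_gt0.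
near=> p.
have [B [mB BA PB]] : exists B : set (Omega p),
    [/\ measurable B, forall t, B t -> A1 (X p t) & (P p (~` B) <= (e / 2)%:E)%E].
  by near: p; exact: Xl.
have [C [mC CA PC]] : exists B : set (Omega p),
    [/\ measurable B, forall t, B t -> A2 (Y p t) & (P p (~` B) <= (e / 2)%:E)%E].
  by near: p; exact: Yk.
exists (B `&` C); split.
- exact: measurableI.
- by move=> t [/BA At /CA Ct]; apply: A12.
- rewrite setCI (le_trans (measureU2 _ _ _))//; [exact: measurableC..|].
  by rewrite [e]splitr EFinD leeD.
Unshelve. all: by end_near. Qed.

Lemma cvg_prob_comp (R : realType) (d : measure_display)
    (Omega : nat -> measurableType d) (P : forall p, probability (Omega p) R)
    (V W : topologicalType) (f : V -> W) (X : forall p, Omega p -> V) (l : V) :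
  {for l, continuous f} -> cvg_prob P X l -> cvg_prob P (fun p t => f (X p t)) (f l).
Proof. by move=> fl Xl A Al; apply: (Xl (f @^-1` A)); exact: fl. Qed.

(** Chebyshev's inequality about the moving centre [a p]: half of the radius [r] absorbs
    [|l - a p|], the other half is compared with the second moment [v p]. *)
Lemma cvg_prob_L2 (R : realType) (d : measure_display)
    (Omega : nat -> measurableType d) (P : forall p, probability (Omega p) R)
    (X : forall p, Omega p -> R) (a v : nat -> R) (l : R) :
  (forall p, measurable_fun setT (X p)) ->
  (\forall p \near \oo, has_mean (P p) (fun t => (X p t - a p) ^+ 2) (v p)) ->
  a @ \oo --> l -> v @ \oo --> 0 -> cvg_prob P X l.
Proof.
move=> mX Xv al v0 A /nbhs_ballP[r /= r0 rA] e e0.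
have r2 : 0 < r / 2 by rewrite divr_gt0.
near=> p.
have hv : has_mean (P p) (fun t => (X p t - a p) ^+ 2) (v p) by near: p.
have ap : `|l - a p| < r / 2 by near: p; apply: cvgr_dist_lt.
have vp : v p < e * (r / 2) ^+ 2.
  by near: p; apply: (cvgr_lt 0) => //; rewrite mulr_gt0// exprn_gt0.
have mC : measurable [set t | r / 2 <= `|X p t - a p|].
  rewrite -[X in measurable X]setTI.
  apply: (measurable_fun_le (f := fun=> r / 2)) => //.
  by apply: measurableT_comp => //; exact: measurable_funB.
exists (~` [set t | r / 2 <= `|X p t - a p|]); split.
- exact: measurableC.
- move=> t /= /negP; rewrite -ltNge => Xa; apply: rA => /=.
  rewrite /ball/= (le_lt_trans (ler_distD (a p) _ _))// [r]splitr ltrD//.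
  by rewrite distrC.
- rewrite setCK -[P p _]fineK ?fin_num_measure// lee_fin.
  rewrite -(ler_pM2r (exprn_gt0 2 r2)) (le_trans _ (ltW vp))// mulrC.
  apply: has_mean_le (has_meanZ _ (has_mean_indic (P p) mC)) hv _ => t.
  rewrite indicE; case: (boolP (t \in _)) => [|_]; last by rewrite mulr0 sqr_ge0.
  rewrite inE/= mulr1 => h.
  by rewrite -[leRHS]ger0_norm ?sqr_ge0// normrX ler_pXn2r ?nnegrE// ltW.
Unshelve. all: by end_near. Qed.

Lemma cvg_prob_bounded_mean (R : realType) (d : measure_display)
    (Omega : nat -> measurableType d) (P : forall p, probability (Omega p) R)
    (X : forall p, Omega p -> R) (l : R) :
  (forall p, measurable_fun setT (X p)) -> (forall p t, 0 <= X p t <= 1) ->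
  cvg_prob P X l ->
  (fun p => \int[P p]_t (X p t)%:E)%E @ \oo --> l%:E.
Proof.
move=> mX X01 Xl.
have /choice[m hm] : forall p, exists m, has_mean (P p) (X p) m.
  by move=> p; exact: bounded_has_mean.
rewrite (_ : (fun p => _) = (fun p => (m p)%:E)); last first.
  by apply/funext => p; exact: (hm p).2.
apply: cvg_EFin; first exact: nearW.
apply/cvgrPdist_le => e e0.
(* [K] bounds [|X - l|] everywhere, as [X] lies in [[0, 1]]; the exceptional event then costs at
   most [e / 2], and so does its complement. *)
pose K := 1 + `|l|; have K0 : 0 < K by rewrite ltr_pwDl.
have e2 : 0 < e / 2 by rewrite divr_gt0.
near=> p.
have [B [mB BA PB]] : exists B : set (Omega p), [/\ measurable B,
    forall t, B t -> ball l (e / 2) (X p t) & (P p (~` B) <= (e / 2 / K)%:E)%E].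
  near: p; apply: Xl; [exact: nbhsx_ballx|exact: divr_gt0].
have hB := has_meanZ K (has_mean_indic (P p) (measurableC mB)).
move: PB; rewrite -[P p _]fineK ?fin_num_measure ?lee_fin; last exact: measurableC.
rewrite ler_pdivlMr// (mulrC _ K) => PB.
pose q := fine (P p (~` B)); have {}PB : K * q <= e / 2 by [].
have hcst c := has_mean_cst (P p) c.
have lK : l <= `|l| by exact: ler_norm.
have NlK : - l <= `|l| by rewrite -[leRHS]normrN ler_norm.
have ub : m p <= l + e / 2 + K * q.
  apply: has_mean_le (hm p) (has_meanD (hcst (l + e / 2)) hB) _ => t.
  rewrite indicE; case: (boolP (t \in _)) => [_|].
    by have /andP[_ X1] := X01 p t; have := e2; rewrite mulr1 /K; lra.
  rewrite notin_setE/= => /contrapT/BA; rewrite /ball/= ltr_norml => /andP[? ?].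
  by have := e2; rewrite mulr0; lra.
have lb : l - e / 2 - K * q <= m p.
  apply: has_mean_le (has_meanB (hcst (l - e / 2)) hB) (hm p) _ => t.
  rewrite indicE; case: (boolP (t \in _)) => [_|].
    by have /andP[X0 _] := X01 p t; have := e2; rewrite mulr1 /K; lra.
  rewrite notin_setE/= => /contrapT/BA; rewrite /ball/= ltr_norml => /andP[? ?].
  by have := e2; rewrite mulr0; lra.
by rewrite /= ler_norml; apply/andP; split; lra.
Unshelve. all: by end_near. Qed.

Lemma cvg_probD (R : realType) (d : measure_display)
    (Omega : nat -> measurableType d) (P : forall p, probability (Omega p) R)
    (X Y : forall p, Omega p -> R) (a b : R) :
  cvg_prob P X a -> cvg_prob P Y b ->
  cvg_prob P (fun p t => X p t + Y p t) (a + b).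
Proof.
move=> Xa Yb; have := cvg_prob_pair Xa Yb.
apply: (cvg_prob_comp (f := fun z : R * R => z.1 + z.2)).
by apply: cvgD; [exact: cvg_fst|exact: cvg_snd].
Qed.

Lemma cvg_probM (R : realType) (d : measure_display)
    (Omega : nat -> measurableType d) (P : forall p, probability (Omega p) R)
    (X Y : forall p, Omega p -> R) (a b : R) :
  cvg_prob P X a -> cvg_prob P Y b ->
  cvg_prob P (fun p t => X p t * Y p t) (a * b).
Proof.
move=> Xa Yb; have := cvg_prob_pair Xa Yb.
apply: (cvg_prob_comp (f := fun z : R * R => z.1 * z.2)).
by apply: cvgM; [exact: cvg_fst|exact: cvg_snd].
Qed.

Lemma cvg_prob_cst (R : realType) (d : measure_display)
    (Omega : nat -> measurableType d) (P : forall p, probability (Omega p) R)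
    (a : R) : cvg_prob P (fun _ _ => a) a.
Proof. by apply: (cvg_prob_seq P (a := fun=> a)); exact: cvg_cst. Qed.

Lemma cvg_probN (R : realType) (d : measure_display)
    (Omega : nat -> measurableType d) (P : forall p, probability (Omega p) R)
    (X : forall p, Omega p -> R) (a : R) :
  cvg_prob P X a -> cvg_prob P (fun p t => - X p t) (- a).
Proof.
by apply: (cvg_prob_comp (f := fun z : R => - z)); exact: opp_continuous.
Qed.

Lemma cvg_probB (R : realType) (d : measure_display)
    (Omega : nat -> measurableType d) (P : forall p, probability (Omega p) R)
    (X Y : forall p, Omega p -> R) (a b : R) :
  cvg_prob P X a -> cvg_prob P Y b ->
  cvg_prob P (fun p t => X p t - Y p t) (a - b).
Proof. by move=> Xa /cvg_probN; exact: cvg_probD. Qed.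

Lemma cvg_prob_invsqrt (R : realType) (d : measure_display)
    (Omega : nat -> measurableType d) (P : forall p, probability (Omega p) R)
    (X : forall p, Omega p -> R) (a : R) : 0 < a ->
  cvg_prob P X a -> cvg_prob P (fun p t => (Num.sqrt (X p t))^-1) (Num.sqrt a)^-1.
Proof.
move=> a0; apply: (cvg_prob_comp (f := fun z : R => (Num.sqrt z)^-1)).
apply: cvgV; first by rewrite gt_eqF// sqrtr_gt0.
exact: sqrt_continuous.
Qed.

(** * The estimator after whitening *)

(** Inversion is continuous off 0, and the point 0 is a separate measurable piece; the estimator is
    thus measurable even where [deltahat] vanishes. *)
Lemma measurable_invr (R : realType) : measurable_fun setT (@GRing.inv R).
Proof.
have -> : setT = [set (0 : R)] `|` ~` [set 0] by rewrite setUv.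
apply/measurable_funU => //; first exact: measurableC.
split; first exact: measurable_fun_set1.
apply: open_continuous_measurable_fun.
  by apply: closed_openC; exact: closed_eq.
by move=> x; rewrite inE/= => /eqP x0; exact: inv_continuous.
Qed.

Lemma measurable_sqrtr (R : realType) : measurable_fun setT (@Num.sqrt R).
Proof. by apply: nondecreasing_measurable => // x y; exact: ler_wsqrtr. Qed.

Definition cdot (R : pzRingType) (p : nat) (u v : 'cV[R]_p) : R :=
  \sum_k u k 0 * v k 0.

Lemma mul_trmx_cdot (R : pzRingType) (p : nat) (u v : 'cV[R]_p) :
  (u^T *m v) 0 0 = cdot u v.
Proof. by rewrite mxE; apply: eq_bigr => k _; rewrite mxE. Qed.

Lemma cdotC (R : comPzRingType) (p : nat) (u v : 'cV[R]_p) : cdot u v = cdot v u.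
Proof. by apply: eq_bigr => k _; rewrite mulrC. Qed.

Lemma cdotDl (R : pzRingType) (p : nat) (u v w : 'cV[R]_p) :
  cdot (u + v) w = cdot u w + cdot v w.
Proof. by rewrite /cdot -big_split; apply: eq_bigr => k _; rewrite mxE mulrDl. Qed.

Lemma cdotZl (R : pzRingType) (p : nat) (a : R) (u w : 'cV[R]_p) :
  cdot (a *: u) w = a * cdot u w.
Proof. by rewrite /cdot mulr_sumr; apply: eq_bigr => k _; rewrite mxE mulrA. Qed.

Lemma cdotNl (R : pzRingType) (p : nat) (u w : 'cV[R]_p) :
  cdot (- u) w = - cdot u w.
Proof. by rewrite -scaleN1r cdotZl mulN1r. Qed.

Lemma cdotDr (R : comPzRingType) (p : nat) (u v w : 'cV[R]_p) :
  cdot w (u + v) = cdot w u + cdot w v.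
Proof. by rewrite cdotC cdotDl !(cdotC w). Qed.

Lemma cdotNr (R : comPzRingType) (p : nat) (u w : 'cV[R]_p) :
  cdot w (- u) = - cdot w u.
Proof. by rewrite cdotC cdotNl (cdotC w). Qed.

Lemma posdef_unitmx (R : realType) (p : nat) (A : 'M[R]_p) :
  (forall v : 'cV[R]_p, v != 0 -> 0 < qf A v v) -> A \in unitmx.
Proof.
move=> Apos; rewrite -row_free_unit -kermx_eq0; apply/rowV0P => u /sub_kermxP uA.
apply/eqP/negPn/negP => u0.
have /Apos : u^T != 0 by rewrite trmx_eq0.
by rewrite /qf trmxK uA mul0mx mxE ltxx.
Qed.

(** [L] is invertible along with [A], and [A = L L^T] makes [L^T A^-1 L] the identity. *)
Lemma qf_invmx_factor (R : realType) (p : nat) (A L : 'M[R]_p) (u v : 'cV[R]_p) :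
  A \in unitmx -> L *m L^T = A -> qf (invmx A) (L *m u) (L *m v) = cdot u v.
Proof.
move=> Au LA; have /andP[Lu _] : (L \in unitmx) && (L^T \in unitmx).
  by rewrite -unitmx_mul LA.
rewrite /qf -mul_trmx_cdot trmx_mul -!mulmxA.
suff -> : L^T *m (invmx A *m (L *m v)) = v by [].
rewrite -[LHS](mulKmx Lu) [L *m (L^T *m _)]mulmxA LA mulKVmx// mulKmx//.
Qed.

(* The Bayesian MMSE error estimator after whitening by [L^-1], as a function
   of [k = n_i / nu_i^*], [rho = sqrt (nu_i^* / (nu_i^* + 1))] and, with [g_j]
   the whitened centred sample means and [u = L^-1 (m_0 - m_1)], of [U = |u|^2],
   [a_j = <u, g_j>], [s_j = |g_j|^2] and [q = |g_0 - g_1|^2]; then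
   [(s0 + s1 - q) / 2 = <g_0, g_1>]. *)
Definition bayes_stat (R : realType) (i : 'I_2) (c k rho U a0 a1 s0 s1 q : R) : R :=
  let x := (s0 + s1 - q) / 2 in
  let N := if i == 0 then
      (U + a0 - a1) / 2 + (k - 2^-1) * (a0 + s0 - x) - (a1 + x - s1) / 2
    else - (U + a0 - a1) / 2 + (k - 2^-1) * (a1 + x - s1) - (a0 + s0 - x) / 2 in
  Phi ((-1) ^+ i * ((- N + c) / Num.sqrt (U + 2 * (a0 - a1) + q) * rho)).

Lemma bayes_err_comp_whitened (R : realType) (p : nat) (Sigma L : 'M[R]_p)
    (c : R) (i : 'I_2) (ni : nat) (nui : R) (u0 u1 g0 g1 : 'cV[R]_p) :
  Sigma \in unitmx -> L *m L^T = Sigma -> 0 < nui ->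
  bayes_err_comp Sigma c i ni nui (L *m (if i == 0 then u0 else u1))
    (L *m (u0 + g0)) (L *m (u1 + g1)) =
  bayes_stat i c (ni%:R / (ni%:R + nui))
    (Num.sqrt ((ni%:R + nui) / (ni%:R + nui + 1)))
    (cdot (u0 - u1) (u0 - u1)) (cdot (u0 - u1) g0) (cdot (u0 - u1) g1)
    (cdot g0 g0) (cdot g1 g1) (cdot (g0 - g1) (g0 - g1)).
Proof.
move=> Su LS nu0; rewrite /bayes_err_comp /bayes_stat; cbv zeta.
have dotE := (cdotDl, cdotDr, cdotNl, cdotNr, cdotZl).
have sym := (cdotC u1 u0, cdotC g0 u0, cdotC g0 u1, cdotC g1 u0, cdotC g1 u1,
  cdotC g1 g0).
set D := u0 + g0 - (u1 + g1).
have QE : cdot D D = cdot (u0 - u1) (u0 - u1)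
    + 2 * (cdot (u0 - u1) g0 - cdot (u0 - u1) g1) + cdot (g0 - g1) (g0 - g1).
  rewrite !dotE !sym.
  move: (cdot u0 u0) (cdot u0 u1) (cdot u1 u1) (cdot u0 g0) (cdot u0 g1)
    (cdot u1 g0) (cdot u1 g1) (cdot g0 g0) (cdot g0 g1) (cdot g1 g1) => *; ring.
set k := ni%:R / (ni%:R + nui).
set x := (cdot g0 g0 + cdot g1 g1 - cdot (g0 - g1) (g0 - g1)) / 2.
have NE : cdot ((if i == 0 then u0 else u1) + k *: (if i == 0 then g0 else g1)
    - 2^-1 *: (u0 + g0 + (u1 + g1))) D =
  if i == 0 then
    (cdot (u0 - u1) (u0 - u1) + cdot (u0 - u1) g0 - cdot (u0 - u1) g1) / 2
    + (k - 2^-1) * (cdot (u0 - u1) g0 + cdot g0 g0 - x)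
    - (cdot (u0 - u1) g1 + x - cdot g1 g1) / 2
  else
    - (cdot (u0 - u1) (u0 - u1) + cdot (u0 - u1) g0 - cdot (u0 - u1) g1) / 2
    + (k - 2^-1) * (cdot (u0 - u1) g1 + x - cdot g1 g1)
    - (cdot (u0 - u1) g0 + cdot g0 g0 - x) / 2.
  rewrite /x /D; case: (i == 0); rewrite !dotE !sym;
  move: (cdot u0 u0) (cdot u0 u1) (cdot u1 u1) (cdot u0 g0) (cdot u0 g1)
    (cdot u1 g0) (cdot u1 g1) (cdot g0 g0) (cdot g0 g1) (cdot g1 g1) k => *; by field.
have ns0 : ni%:R + nui != 0 :> R by rewrite gt_eqF// ltr_wpDl.
rewrite -mulmxBr -/D.
(* Posterior averaging shrinks only the noise: [u_i + g_i] and [u_i], with weights [n_i] and [nu_i],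
   average to [u_i + k g_i]. *)
have mstarE (A B : 'cV[R]_p) :
    (ni%:R + nui)^-1 *: (ni%:R *: (A + B) + nui *: A) =
    A + (ni%:R / (ni%:R + nui)) *: B.
  by apply/matrixP => r s; rewrite !mxE; field.
rewrite (_ : _ - 2^-1 *: _ = L *m ((if i == 0 then u0 else u1) +
  k *: (if i == 0 then g0 else g1)
  - 2^-1 *: (u0 + g0 + (u1 + g1)))); last first.
  rewrite mulmxBr mulmxDr.
  by case: (i == 0); rewrite -[L *m (2^-1 *: _)]scalemxAr !mulmxDr mstarE scalemxAr.
by rewrite !qf_invmx_factor// NE QE.
Qed.

Lemma sum_ord2 (R : nmodType) (F : 'I_2 -> R) : \sum_i F i = F 0 + F 1.
Proof.
by rewrite !big_ord_recl big_ord0 addr0; congr (_ + F _); exact: val_inj.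
Qed.

Lemma sum_option (R : nmodType) (T : finType) (F : option T -> R) :
  \sum_o F o = F None + \sum_x F (Some x).
Proof.
rewrite (bigD1 None)//=; congr (_ + _).
rewrite (reindex_omap Some id) => [|[]//].
by apply: eq_bigl => x; rewrite /= eqxx.
Qed.

Lemma sum_gcoord_index (R : nmodType) (p : nat) (n : 'I_2 -> nat)
    (F : {i : 'I_2 & option 'I_(n i)} * 'I_p -> R) :
  \sum_k F k = \sum_i \sum_j (F (existT _ i None, j)
    + \sum_l F (existT (fun i => option 'I_(n i)) i (Some l), j)).
Proof.
transitivity (\sum_(a : {i : 'I_2 & option 'I_(n i)}) \sum_j F (a, j)).
  by rewrite pair_bigA; apply: eq_bigr => -[].
transitivity (\sum_i \sum_(o : option 'I_(n i)) \sum_j F (existT _ i o, j)).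
  rewrite (sig_big_dep _ (fun _ _ => true)
    (fun i (o : option 'I_(n i)) => \sum_j F (existT _ i o, j)))/=.
  by apply: eq_bigr => -[].
apply: eq_bigr => i _; rewrite sum_option big_split/=; congr (_ + _).
exact: exchange_big.
Qed.

(** In the model this is [L^-1 (xbar_i - m_i)]: the deviation of the class mean under the prior plus
    the averaged sampling noise. *)
Definition gmean (R : realType) (T : Type) (p : nat) (n : 'I_2 -> nat)
    (nu : 'I_2 -> R) (z : 'I_2 -> T -> 'cV[R]_p)
    (w : forall i : 'I_2, 'I_(n i) -> T -> 'cV[R]_p) (i : 'I_2) (t : T) : 'cV[R]_p :=
  (Num.sqrt (nu i))^-1 *: z i t + (n i)%:R^-1 *: \sum_l w i l t.

(* Coefficients of [<al 0, g_0> + <al 1, g_1>] in the coordinates [gcoord z w]. *)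
Definition gcoef (R : realType) (p : nat) (n : 'I_2 -> nat) (nu : 'I_2 -> R)
    (al : 'I_2 -> 'cV[R]_p) (k : {i : 'I_2 & option 'I_(n i)} * 'I_p) : R :=
  let: existT i o := k.1 in
  al i k.2 0 * (if o is None then (Num.sqrt (nu i))^-1 else (n i)%:R^-1).

Definition gvar (R : realType) (n : 'I_2 -> nat) (nu : 'I_2 -> R) (i : 'I_2) : R :=
  (nu i)^-1 + (n i)%:R^-1.

Lemma lin_form_gcoef (R : realType) (T : Type) (p : nat) (n : 'I_2 -> nat)
    (nu : 'I_2 -> R) (z : 'I_2 -> T -> 'cV[R]_p)
    (w : forall i : 'I_2, 'I_(n i) -> T -> 'cV[R]_p) (al : 'I_2 -> 'cV[R]_p) (t : T) :
  lin_form (gcoord z w) (gcoef nu al) t = \sum_i cdot (al i) (gmean nu z w i t).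
Proof.
rewrite /lin_form sum_gcoord_index; apply: eq_bigr => i _.
apply: eq_bigr => j _; rewrite /gcoef /gcoord/= !mxE summxE.
rewrite mulrDr mulrA; congr (_ + _).
by rewrite mulrA mulr_sumr.
Qed.

(** The two classes share no coordinates. Within class [i] the prior term contributes [1/nu_i], and
    the [n_i] sampling terms of weight [1/n_i] contribute [1/n_i] together. *)
Lemma dotf_gcoef (R : realType) (p : nat) (n : 'I_2 -> nat)
    (nu : 'I_2 -> R) (al be : 'I_2 -> 'cV[R]_p) :
  (forall i, 0 < n i)%N -> (forall i, 0 < nu i) ->
  dotf (gcoef (n := n) nu al) (gcoef nu be) =
  \sum_i gvar n nu i * cdot (al i) (be i).
Proof.
move=> n0 nu0; rewrite /dotf sum_gcoord_index; apply: eq_bigr => i _.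
rewrite /cdot mulr_sumr; apply: eq_bigr => j _; rewrite /gcoef/= sumr_const card_ord.
have ni0 : (n i)%:R != 0 :> R by rewrite pnatr_eq0 -lt0n.
rewrite mulrACA -invfM -expr2 sqr_sqrtr ?ltW// -mulr_natr /gvar.
by field; rewrite ni0 gt_eqF.
Qed.

Lemma measurable_lin_form (d : measure_display) (T : measurableType d)
    (R : realType) (I : finType) (X : I -> T -> R) (a : I -> R) :
  (forall i, measurable_fun setT (X i)) -> measurable_fun setT (lin_form X a).
Proof.
by move=> mX; apply: measurable_sum => i; apply: measurable_funM.
Qed.

(** Measurability is stated apart from the moment because it is used for every [p], whereas the
    sample sizes are known to be positive only for large [p]. *)
Lemma gmean_linear_variance (d : measure_display) (T : measurableType d)
    (R : realType) (P : probability T R) (p : nat) (n : 'I_2 -> nat)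
    (nu : 'I_2 -> R) (z : 'I_2 -> T -> 'cV[R]_p)
    (w : forall i : 'I_2, 'I_(n i) -> T -> 'cV[R]_p) (u : 'cV[R]_p) (i : 'I_2) :
  mutually_independent P (gcoord z w) ->
  (forall k, std_normal_rv P (gcoord z w k)) ->
  measurable_fun setT (fun t => cdot u (gmean nu z w i t)) /\
  ((forall i, 0 < n i)%N -> (forall i, 0 < nu i) ->
   has_mean P (fun t => (cdot u (gmean nu z w i t) - 0) ^+ 2)
     (gvar n nu i * cdot u u)).
Proof.
move=> ind nX; pose al (j : 'I_2) : 'cV[R]_p := if j == i then u else 0.
have cdot0 (v : 'cV[R]_p) : cdot 0 v = 0.
  by rewrite /cdot big1// => k _; rewrite mxE mul0r.
have E : (fun t => cdot u (gmean nu z w i t)) = lin_form (gcoord z w) (gcoef nu al).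
  apply/funext => t; rewrite lin_form_gcoef (bigD1 i)//= /al eqxx big1 ?addr0//.
  by move=> j /negPf ->.
split; first by rewrite E; apply: measurable_lin_form => k; have [] := nX k.
move=> n0 nu0; have := lin_form_mean2 (gcoef nu al) (gcoef nu al) ind nX.
rewrite -E dotf_gcoef// (bigD1 i)//= /al eqxx big1 ?addr0.
  by congr has_mean; apply/funext => t; rewrite subr0.
by move=> j /negPf ->; rewrite cdot0 mulr0.
Qed.

(** The coordinates of [G] are [p] uncorrelated linear forms of variance [S]. The weights [(1, 0)],
    [(0, 1)] and [(1, -1)] cover the three squared norms in [bayes_stat]. *)
Lemma gmean_sqnorm_variance (d : measure_display) (T : measurableType d)
    (R : realType) (P : probability T R) (p : nat) (n : 'I_2 -> nat)
    (nu : 'I_2 -> R) (z : 'I_2 -> T -> 'cV[R]_p)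
    (w : forall i : 'I_2, 'I_(n i) -> T -> 'cV[R]_p) (a b : R) :
  mutually_independent P (gcoord z w) ->
  (forall k, std_normal_rv P (gcoord z w k)) ->
  let G t := a *: gmean nu z w 0 t + b *: gmean nu z w 1 t in
  let S := a ^+ 2 * gvar n nu 0 + b ^+ 2 * gvar n nu 1 in
  measurable_fun setT (fun t => cdot (G t) (G t)) /\
  ((forall i, 0 < n i)%N -> (forall i, 0 < nu i) ->
   has_mean P (fun t => (cdot (G t) (G t) - p%:R * S) ^+ 2) (2 * p%:R * S ^+ 2)).
Proof.
move=> ind nX G S.
pose lam (i : 'I_2) : R := if i == 0 then a else b.
pose al (j : 'I_p) (i : 'I_2) : 'cV[R]_p := lam i *: delta_mx j 0.
have cdotd j (v : 'cV[R]_p) : cdot (delta_mx j 0) v = v j 0.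
  rewrite /cdot (bigD1 j)//= mxE !eqxx mul1r big1 ?addr0// => k /negPf kj.
  by rewrite mxE kj mul0r.
have E : (fun t => cdot (G t) (G t)) =
    (fun t => \sum_j lin_form (gcoord z w) (gcoef nu (al j)) t ^+ 2).
  apply/funext => t; apply: eq_bigr => j _; rewrite lin_form_gcoef sum_ord2.
  by rewrite /al !cdotZl !cdotd /G !mxE expr2.
split.
  rewrite E; apply: measurable_sum => j; apply: measurable_funX.
  by apply: measurable_lin_form => k; have [] := nX k.
move=> n0 nu0.
have : has_mean P (fun t => (\sum_j lin_form (gcoord z w) (gcoef nu (al j)) t ^+ 2
    - p%:R * S) ^+ 2) (2 * p%:R * S ^+ 2).
  apply: lin_form_sqnorm_variance => // j k.
  rewrite dotf_gcoef// sum_ord2 /al !cdotZl !cdotd !mxE/=.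
  by rewrite eqxx andbT /S /lam/=; ring.
by congr has_mean; apply/funext => t; rewrite -(congr1 (@^~ t) E).
Qed.

Lemma bayes_stat_ge0 (R : realType) (i : 'I_2) (c k rho U a0 a1 s0 s1 q : R) :
  0 <= bayes_stat i c k rho U a0 a1 s0 s1 q.
Proof. exact: Phi_ge0. Qed.

Lemma bayes_stat_le1 (R : realType) (i : 'I_2) (c k rho U a0 a1 s0 s1 q : R) :
  bayes_stat i c k rho U a0 a1 s0 s1 q <= 1.
Proof. exact: Phi_le1. Qed.

Lemma measurable_bayes_stat (R : realType) (d : measure_display)
    (T : measurableType d) (i : 'I_2) (c k rho U : R) (a0 a1 s0 s1 q : T -> R) :
  measurable_fun setT a0 -> measurable_fun setT a1 -> measurable_fun setT s0 ->
  measurable_fun setT s1 -> measurable_fun setT q ->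
  measurable_fun setT
    (fun t => bayes_stat i c k rho U (a0 t) (a1 t) (s0 t) (s1 t) (q t)).
Proof.
move=> ma0 ma1 ms0 ms1 mq; rewrite /bayes_stat.
have mcst r : measurable_fun setT (fun _ : T => r : R) by exact: measurable_cst.
have mN (f : T -> R) : measurable_fun setT f -> measurable_fun setT (fun t => - f t).
  by move=> mf; exact: measurableT_comp.
apply: (measurableT_comp (@measurable_Phi R)).
apply: measurable_funM => //; apply: measurable_funM => //; apply: measurable_funM.
  apply: measurable_funD => //; apply: mN.
  by case: (i == 0); do ![apply: measurable_funB => //
    |apply: measurable_funD => //|apply: measurable_funM => //
    |apply: measurable_funN => //].
apply: (measurableT_comp (@measurable_invr R)).
apply: (measurableT_comp (@measurable_sqrtr R)).
by do ![apply: measurable_funB => //|apply: measurable_funD => //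
  |apply: measurable_funM => //].
Qed.

(** Continuous mapping; the last hypothesis keeps the inverse square root continuous at the limit
    point, where its argument will be [Flim]. *)
Lemma cvg_prob_bayes_stat (R : realType) (d : measure_display)
    (Omega : nat -> measurableType d) (P : forall p, probability (Omega p) R)
    (i : 'I_2) (c : R) (k rho U : nat -> R) (a0 a1 s0 s1 q : forall p, Omega p -> R)
    (lk lrho lU la0 la1 ls0 ls1 lq : R) :
  k @ \oo --> lk -> rho @ \oo --> lrho -> U @ \oo --> lU ->
  cvg_prob P a0 la0 -> cvg_prob P a1 la1 -> cvg_prob P s0 ls0 ->
  cvg_prob P s1 ls1 -> cvg_prob P q lq -> 0 < lU + 2 * (la0 - la1) + lq ->
  cvg_prob P
    (fun p t => bayes_stat i c (k p) (rho p) (U p) (a0 p t) (a1 p t) (s0 p t)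
                  (s1 p t) (q p t))
    (bayes_stat i c lk lrho lU la0 la1 ls0 ls1 lq).
Proof.
move=> /(cvg_prob_seq P) ck /(cvg_prob_seq P) crho /(cvg_prob_seq P) cU.
move=> ca0 ca1 cs0 cs1 cq Q0; rewrite /bayes_stat.
apply: (cvg_prob_comp (f := @Phi R)); first exact: continuous_Phi.
have cc r := cvg_prob_cst P r.
have {}cc r : cvg_prob P (fun _ _ => r : R) r := cc r.
apply: cvg_probM; first exact: cc.
apply: cvg_probM => //; apply: cvg_probM.
  apply: cvg_probD; last exact: cc.
  apply: cvg_probN.
  by case: (i == 0); do ![exact: cc|apply: cvg_probB => //
    |apply: cvg_probD => //|apply: cvg_probM => //|apply: cvg_probN => //].
apply: cvg_prob_invsqrt => //.
by do ![exact: cc|apply: cvg_probB => //|apply: cvg_probD => //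
  |apply: cvg_probM => //].
Qed.

(** The value of [q] is the sum of those of [s0] and [s1], so [x = 0]: the two noises are orthogonal
    in the limit. As [(1 + gamma)^-1 * (J / gamma + J) = J / gamma], class [i] itself contributes
    [(J / gamma - J) / 2] and the other class [(J / gamma + J) / 2], up to the sign [(-1)^i]; hence
    the opposite signs of [J 0] and [J 1] in [Hlim]. *)
Lemma bayes_stat_limit (R : realType) (i : 'I_2) (c Dbar : R) (J gamma : 'I_2 -> R) :
  (forall i, 0 < gamma i) ->
  bayes_stat i c (1 + gamma i)^-1 1 Dbar 0 0 (J 0 / gamma 0 + J 0)
    (J 1 / gamma 1 + J 1) (J 0 / gamma 0 + J 0 + (J 1 / gamma 1 + J 1)) =
  Phi ((-1) ^+ i * ((- Hlim Dbar J gamma i + c) / Num.sqrt (Flim Dbar J gamma))).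
Proof.
move=> gamma0; have g0 := gamma0 0; have g1 := gamma0 1.
have n0 : gamma 0 != 0 by rewrite gt_eqF.
have n1 : gamma 1 != 0 by rewrite gt_eqF.
have m0 : 1 + gamma 0 != 0 by rewrite gt_eqF// addr_gt0.
have m1 : 1 + gamma 1 != 0 by rewrite gt_eqF// addr_gt0.
rewrite /bayes_stat /Hlim /Flim mulr1.
set Q := Dbar + 2 * _ + _.
have -> : Q = Dbar + J 0 + J 1 + J 0 / gamma 0 + J 1 / gamma 1 by rewrite /Q; ring.
have [->|i1] := eqVneq i 0.
  set N := (_ + _ - _) / 2 + _ - _.
  have -> // : N = 2^-1 * (Dbar + J 1 - J 0 + J 0 / gamma 0 + J 1 / gamma 1).
  by rewrite /N; field; rewrite n0 n1 m0.
have -> : i = 1 by apply: val_inj; case: i i1 => -[|[|]].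
set N := - _ / 2 + _ - _.
have -> // : N = - 2^-1 * (Dbar + J 0 - J 1 + J 0 / gamma 0 + J 1 / gamma 1).
by rewrite /N; field; rewrite n0 n1 m1.
Qed.

(** * The asymptotic regime *)

Lemma cvg_invn (R : realType) : (n%:R^-1 : R) @[n --> \oo] --> (0 : R).
Proof. by rewrite -(cvg_shiftS (fun n => n%:R^-1 : R)); exact: cvg_harmonic. Qed.

(** [s] is the coordinate variance of the noise of one class; [J / gamma] arises as the limit of
    [p / nu = (p / n) / (nu / n)]. *)
Lemma class_regime (R : realType) (n : nat -> nat) (nu : nat -> R) (J gamma : R) :
  (forall p, 0 < nu p) -> (\forall p \near \oo, (0 < n p)%N) ->
  (fun p => p%:R / (n p)%:R) @ \oo --> J -> 0 < gamma ->
  (fun p => nu p / (n p)%:R) @ \oo --> gamma ->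
  let s p := (nu p)^-1 + (n p)%:R^-1 in
  [/\ (fun p => p%:R * s p) @ \oo --> J / gamma + J,
      s @ \oo --> (0 : R),
      (fun p => (n p)%:R / ((n p)%:R + nu p)) @ \oo --> (1 + gamma)^-1 &
      (fun p => Num.sqrt (((n p)%:R + nu p) / ((n p)%:R + nu p + 1))) @ \oo --> (1 : R)].
Proof.
move=> nu0 n0 pJ gamma0 nug s.
have ps : (fun p => p%:R * s p) @ \oo --> J / gamma + J.
  have : (fun p => p%:R / (n p)%:R / (nu p / (n p)%:R) + p%:R / (n p)%:R) @ \oo
      --> J / gamma + J.
    by apply: cvgD => //; apply: cvgM => //; apply: cvgV => //; rewrite gt_eqF.
  move=> h; apply: cvg_trans h; apply: near_eq_cvg; near=> p.
  have np : (n p)%:R != 0 :> R by rewrite pnatr_eq0 -lt0n; near: p.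
  by rewrite /= /s; field; rewrite np gt_eqF.
have s0 : s @ \oo --> (0 : R).
  have : (fun p => p%:R * s p * p%:R^-1) @ \oo --> (0 : R).
    by rewrite -[X in _ --> X](mulr0 (J / gamma + J)); apply: cvgM => //; exact: cvg_invn.
  move=> h; apply: cvg_trans h; apply: near_eq_cvg; near=> p.
  rewrite /= mulrAC mulfV ?mul1r// pnatr_eq0 -lt0n; near: p; exact: nbhs_infty_gt.
split=> //.
- have g1 : 1 + gamma != 0 by rewrite gt_eqF// addr_gt0.
  have : (fun p => (1 + nu p / (n p)%:R)^-1) @ \oo --> (1 + gamma)^-1.
    by apply: cvgV => //; apply: cvgD => //; exact: cvg_cst.
  move=> h; apply: cvg_trans h; apply: near_eq_cvg; near=> p.
  have np : 0 < (n p)%:R :> R by rewrite ltr0n; near: p.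
  rewrite /=; field; rewrite !gt_eqF//= addr_gt0//.
- rewrite -[X in _ --> X]sqrtr1.
  apply: (cvg_comp _ (@Num.sqrt R)); last exact: sqrt_continuous.
  (* This is the distance to 1 of the ratio under the root; it lies between 0 and [1 / nu <= s]. *)
  have : (fun p => ((n p)%:R + nu p + 1)^-1) @ \oo --> (0 : R).
    apply: (squeeze_cvgr _ (cvg_cst 0) s0); apply: nearW => p.
    have np : 0 <= (n p)%:R :> R by [].
    have nup := nu0 p.
    apply/andP; split; first by rewrite invr_ge0; lra.
    apply: (@le_trans _ _ (nu p)^-1); last by rewrite lerDl invr_ge0.
    by rewrite lef_pV2 ?posrE//; lra.
  move=> inv0.
  have : (fun p => 1 - ((n p)%:R + nu p + 1)^-1) @ \oo --> (1 : R).
    by rewrite -[X in _ --> X]subr0; apply: cvgB => //; exact: cvg_cst.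
  move=> h; apply: cvg_trans h; apply: near_eq_cvg; apply: nearW => p.
  have np : 0 <= (n p)%:R :> R by [].
  by rewrite /=; field; rewrite gt_eqF//; have := nu0 p; lra.
Unshelve. all: by end_near. Qed.

Unset Implicit Arguments.

Theorem theorem5 (R : realType)
  (* prior class probability alpha_0 in (0,1); alpha_1 = 1 - alpha_0 *)
  (alpha0 : R)
  (* dimension-indexed data *)
  (Sigma : forall p : nat, 'M[R]_p)
  (n : 'I_2 -> nat -> nat) (nu : 'I_2 -> nat -> R)
  (m : 'I_2 -> forall p : nat, 'cV[R]_p)
  (* asymptotic parameters *)
  (J gamma : 'I_2 -> R) (Dbar : R)
  (* probability spaces and random objects, for each p *)
  (d : measure_display) (Omega : nat -> measurableType d)
  (P : forall p : nat, probability (Omega p) R)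
  (L : forall p : nat, 'M[R]_p)
  (z : forall p : nat, 'I_2 -> Omega p -> 'cV[R]_p)
  (w : forall (p : nat) (i : 'I_2), 'I_(n i p) -> Omega p -> 'cV[R]_p)
  (mu : forall p : nat, 'I_2 -> Omega p -> 'cV[R]_p)
  (x : forall (p : nat) (i : 'I_2), 'I_(n i p) -> Omega p -> 'cV[R]_p) :
  0 < alpha0 < 1 ->
  (* Sigma symmetric positive definite *)
  (forall p, (Sigma p)^T = Sigma p) ->
  (forall p (v : 'cV[R]_p), v != 0 -> 0 < qf (Sigma p) v v) ->
  (forall i p, 0 < nu i p) ->
  (* model: L L^T = Sigma, z_i, w_{i,k} i.i.d. standard Gaussian vectors,
     mu_i = m_i + L z_i / sqrt nu_i  (so mu_i ~ N(m_i, Sigma/nu_i)),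
     x_{i,k} = mu_i + L w_{i,k}      (so given mu, x_{i,k} ~ N(mu_i, Sigma) iid) *)
  (forall p, L p *m (L p)^T = Sigma p) ->
  (forall p, mutually_independent (P p) (gcoord (z p) (w p))) ->
  (forall p k, std_normal_rv (P p) (gcoord (z p) (w p) k)) ->
  (forall p i t, mu p i t = m i p + (Num.sqrt (nu i p))^-1 *: (L p *m z p i t)) ->
  (forall p i k t, x p i k t = mu p i t + L p *m w p i k t) ->
  (* unconditional asymptotic regime *)
  (forall i (N : nat), \forall p \near \oo, (N <= n i p)%N) ->
  (forall i, nu i @ \oo --> +oo) ->
  (forall i, 0 <= J i) ->
  (forall i, (fun p => p%:R / (n i p)%:R) @ \oo --> J i) ->
  (forall i, 0 < gamma i) ->
  (forall i, (fun p => nu i p / (n i p)%:R) @ \oo --> gamma i) ->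
  (forall i j, exists l : R,
      (fun p => qf (invmx (Sigma p)) (m i p) (m j p)) @ \oo --> l) ->
  (fun p => qf (invmx (Sigma p)) (m 0 p - m 1 p) (m 0 p - m 1 p)) @ \oo --> Dbar ->
  0 < Flim Dbar J gamma ->
  let c := ln ((1 - alpha0) / alpha0) in
  let eB := fun p (i : 'I_2) (t : Omega p) =>
    bayes_err_comp (Sigma p) c i (n i p) (nu i p) (m i p)
      (smean (fun k => x p 0 k t)) (smean (fun k => x p 1 k t)) in
  let lim_i := fun i : 'I_2 =>
    Phi ((-1) ^+ i * ((- Hlim Dbar J gamma i + c) / Num.sqrt (Flim Dbar J gamma))) in
  (forall i j : 'I_2,
     (fun p => (\int[P p]_t (eB p i t * eB p j t)%:E)%E) @ \oo
       --> ((lim_i i * lim_i j)%:E)) /\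
  ((fun p => (\int[P p]_t ((alpha0 * eB p 0 t + (1 - alpha0) * eB p 1 t) ^+ 2)%:E)%E)
     @ \oo
   --> (((alpha0 * Phi ((- Hlim Dbar J gamma 0 + c) / Num.sqrt (Flim Dbar J gamma))
         + (1 - alpha0) * Phi ((Hlim Dbar J gamma 1 - c) / Num.sqrt (Flim Dbar J gamma)))
        ^+ 2)%:E)).
Proof.
move=> alpha01 _ Spos nu0 LS ind nX muE xE ngt _ _ pJ gamma0 nug _ cU F0 c eB lim_i.
have Su p : Sigma p \in unitmx by exact: posdef_unitmx (Spos p).
have Lu p : L p \in unitmx.
  have : L p *m (L p)^T \in unitmx by rewrite LS.
  by rewrite unitmx_mul => /andP[].
pose u p i : 'cV[R]_p := invmx (L p) *m m i p.
have LuE p i : L p *m u p i = m i p by rewrite mulKVmx.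
pose np p i := n i p.
pose nup p i := nu i p.
have nup0 p i : 0 < nup p i by exact: nu0.
pose g p (i : 'I_2) t : 'cV[R]_p := gmean (n := np p) (nup p) (z p) (w p) i t.
pose U p := cdot (u p 0 - u p 1) (u p 0 - u p 1).
pose A i p t := cdot (u p 0 - u p 1) (g p i t).
pose G a b p t := cdot (a *: g p 0 t + b *: g p 1 t) (a *: g p 0 t + b *: g p 1 t).
pose k i p : R := (n i p)%:R / ((n i p)%:R + nu i p).
pose rho i p : R := Num.sqrt (((n i p)%:R + nu i p) / ((n i p)%:R + nu i p + 1)).
pose Z i p t := bayes_stat i c (k i p) (rho i p) (U p) (A 0 p t) (A 1 p t)
  (G 1 0 p t) (G 0 1 p t) (G 1 (-1) p t).
have n0 i : \forall p \near \oo, (0 < n i p)%N by exact: ngt.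
have n01 : \forall p \near \oo, forall i, (0 < np p i)%N.
  have n00 := n0 0; have n10 := n0 1; near=> p => i.
  have [->|i1] := eqVneq i 0; first by near: p.
  have -> : i = 1 by apply: val_inj; case: i i1 => -[|[|]].
  by near: p.
(* Only for large [p]: an empty sample has [smean] equal to 0, which is not of the form assumed by
   the whitening. *)
have eBZ : \forall p \near \oo, forall i t, eB p i t = Z i p t.
  near=> p => i t.
  have npos j : (n j p)%:R != 0 :> R.
    by rewrite pnatr_eq0 -lt0n; move: (j); near: p; exact: n01.
  have smeanE j : smean (fun l => x p j l t) = L p *m (u p j + g p j t).
    rewrite /smean (eq_bigr _ (fun l _ => xE p j l t)) big_split/=.
    rewrite sumr_const card_ord -mulmx_sumr scalerDr -[mu p j t *+ _]scaler_nat scalerA.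
    rewrite mulVf// scale1r muE -LuE scalemxAr -addrA scalemxAr -!mulmxDr.
    by [].
  have miE : m i p = L p *m (if i == 0 then u p 0 else u p 1).
    have [->|i1] := eqVneq i 0; first by rewrite LuE.
    by rewrite LuE; congr (m _ p); apply: val_inj; case: i i1 => -[|[|]].
  have := bayes_err_comp_whitened c i (n i p) (u p 0) (u p 1) (g p 0 t) (g p 1 t)
    (Su p) (LS p) (nu0 i p).
  rewrite /eB !smeanE miE => ->.
  by rewrite /Z /G !scale1r !scale0r !addr0 !add0r scaleN1r.
have reg i := class_regime (nu0 i) (n0 i) (pJ i) (gamma0 i) (nug i).
have cU' : U @ \oo --> Dbar.
  rewrite (_ : U = fun p => qf (invmx (Sigma p)) (m 0 p - m 1 p) (m 0 p - m 1 p))//.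
  by apply/funext => p; rewrite -!LuE -mulmxBr (qf_invmx_factor _ _ (Su p) (LS p)).
have mA i p : measurable_fun setT (A i p).
  exact: (gmean_linear_variance (nup p) (u p 0 - u p 1) i (ind p) (nX p)).1.
have mG a b p : measurable_fun setT (G a b p).
  exact: (gmean_sqnorm_variance (nup p) a b (ind p) (nX p)).1.
have mZ i p : measurable_fun setT (Z i p) by exact: measurable_bayes_stat.
have cA i : cvg_prob P (A i) 0.
  apply: (cvg_prob_L2 (a := fun=> 0)
    (v := fun p => gvar (np p) (nup p) i * U p)) => //.
  - near=> p.
    have npos : forall i, (0 < np p i)%N by near: p; exact: n01.
    exact: (gmean_linear_variance (nup p) (u p 0 - u p 1) i (ind p) (nX p)).2.
  - exact: cvg_cst.
  - have [_ s0 _ _] := reg i.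
    by rewrite -[X in _ --> X](mul0r Dbar); exact: cvgM.
have cG a b : cvg_prob P (G a b)
    (a ^+ 2 * (J 0 / gamma 0 + J 0) + b ^+ 2 * (J 1 / gamma 1 + J 1)).
  have [ps0 s0 _ _] := reg 0; have [ps1 s1 _ _] := reg 1.
  pose S p := a ^+ 2 * gvar (np p) (nup p) 0 + b ^+ 2 * gvar (np p) (nup p) 1.
  have cS : S @ \oo --> (0 : R).
    have : S @ \oo --> a ^+ 2 * 0 + b ^+ 2 * 0 by apply: cvgD; apply: cvgMr.
    by rewrite !mulr0 addr0.
  have cpS : (fun p => p%:R * S p) @ \oo -->
      a ^+ 2 * (J 0 / gamma 0 + J 0) + b ^+ 2 * (J 1 / gamma 1 + J 1).
    under eq_fun do rewrite mulrDr mulrCA [X in _ + X]mulrCA.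
    by apply: cvgD; apply: cvgMr.
  (* [p * S] converges while [S] tends to 0, so the variance [2 (p S) S] vanishes. *)
  have cv : (fun p => 2 * p%:R * S p ^+ 2) @ \oo --> (0 : R).
    rewrite (_ : (fun p => _) = fun p => 2 * (p%:R * S p) * S p).
      rewrite -[X in _ --> X](mulr0 (2 * (a ^+ 2 * (J 0 / gamma 0 + J 0)
        + b ^+ 2 * (J 1 / gamma 1 + J 1)))).
      by apply: cvgM => //; exact: cvgMr.
    by apply/funext => p; ring.
  apply: (cvg_prob_L2 (a := fun p => p%:R * S p)
    (v := fun p => 2 * p%:R * S p ^+ 2)) => //.
  near=> p.
  have npos : forall i, (0 < np p i)%N by near: p; exact: n01.
  exact: (gmean_sqnorm_variance (nup p) a b (ind p) (nX p)).2.
have cZ i : cvg_prob P (Z i) (lim_i i).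
  rewrite /lim_i -bayes_stat_limit//.
  have [_ _ ck crho] := reg i.
  have cG10 := cG 1 0; have cG01 := cG 0 1; have cG11 := cG 1 (-1).
  rewrite expr1n expr0n/= !mul1r !mul0r addr0 in cG10.
  rewrite expr1n expr0n/= !mul1r !mul0r add0r in cG01.
  rewrite sqrrN !expr1n !mul1r in cG11.
  apply: cvg_prob_bayes_stat => //.
  by move: F0; rewrite /Flim; lra.
have Z01 i p t : 0 <= Z i p t <= 1 by rewrite bayes_stat_ge0 bayes_stat_le1.
split=> [i j|].
  (* The limit is proved for [Z], measurable with values in [[0, 1]] at every [p], and then
     transferred to [eB], which agrees with it for large [p]. *)
  have ZZ : (fun p => \int[P p]_t (Z i p t * Z j p t)%:E)%E @ \oo -->
      (lim_i i * lim_i j)%:E.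
    apply: cvg_prob_bounded_mean.
    - by move=> p; exact: measurable_funM.
    - move=> p t; have /andP[? ?] := Z01 i p t; have /andP[? ?] := Z01 j p t.
      by rewrite mulr_ge0//= mulr_ile1.
    - exact: cvg_probM.
  apply: cvg_trans ZZ; apply: near_eq_cvg; near=> p.
  apply: eq_integral => t _.
  have eBZp : forall i t, eB p i t = Z i p t by near: p; exact: eBZ.
  by rewrite !eBZp.
have lim0 : Phi ((- Hlim Dbar J gamma 0 + c) / Num.sqrt (Flim Dbar J gamma)) = lim_i 0.
  by rewrite /lim_i expr0 mul1r.
have lim1 : Phi ((Hlim Dbar J gamma 1 - c) / Num.sqrt (Flim Dbar J gamma)) = lim_i 1.
  by rewrite /lim_i [(-1) ^+ _]expr1 mulN1r -mulNr opprD opprK.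
rewrite lim0 lim1.
have /andP[alpha_gt0 alpha_lt1] := alpha01.
(* The squared combination is handled directly rather than by expansion into product moments: a
   convex combination of values in [[0, 1]] stays there, and so does its square. *)
have ZZ : (fun p => \int[P p]_t
    ((alpha0 * Z 0 p t + (1 - alpha0) * Z 1 p t) ^+ 2)%:E)%E @ \oo -->
    ((alpha0 * lim_i 0 + (1 - alpha0) * lim_i 1) ^+ 2)%:E.
  apply: cvg_prob_bounded_mean.
  - move=> p; apply: measurable_funX; apply: measurable_funD.
      by apply: measurable_funM.
    by apply: measurable_funM.
  - move=> p t; have /andP[? ?] := Z01 0 p t; have /andP[? ?] := Z01 1 p t.
    by rewrite sqr_ge0 expr_le1//; nra.
  - have cc r := cvg_prob_cst P r.
    have cD : cvg_prob P (fun p t => alpha0 * Z 0 p t + (1 - alpha0) * Z 1 p t)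
        (alpha0 * lim_i 0 + (1 - alpha0) * lim_i 1).
      apply: cvg_probD.
        by apply: cvg_probM; [exact: cc|exact: cZ].
      by apply: cvg_probM; [exact: cc|exact: cZ].
    rewrite expr2; exact: cvg_probM.
apply: cvg_trans ZZ; apply: near_eq_cvg; near=> p.
apply: eq_integral => t _.
have eBZp : forall i t, eB p i t = Z i p t by near: p; exact: eBZ.
by rewrite !eBZp.
Unshelve. all: by end_near. Qed.
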